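(* Let $(\epsilon_y)_{y\in\mathbb{Z}}$ be an i.i.d. family of $\{-1,1\}$-valued Rademacher random variables, and let $\mathbf{H}_\epsilon$ be the honeycomb lattice oriented randomly as follows: if $\epsilon_y=1$ there is, for every $x\in\mathbb{Z}$, only a right-directed edge from $(x,y)$ to $(x+1,y)$; if $\epsilon_y=-1$ there is, for every $x\in\mathbb{Z}$, only a left-directed edge from $(x+1,y)$ to $(x,y)$. Vertical edges are undirected. Then, for almost every realization of $\epsilon$, the simple random walk $(M_n)_{n\ge 0}$ on $\mathbf{H}_\epsilon$ is transient.
   Context: The honeycomb lattice is the graph with vertex set $\mathbb{Z}^2$ obtained from the nearest-neighbour square lattice by deleting, for all $j,k\in\mathbb{Z}$, the vertical edges between $(2j,2k)$ and $(2j,2k+1)$ and between $(2j+1,2k+1)$ and $(2j+1,2k+2)$. Thus all horizontal nearest-neighbour edges are kept, and the vertical edge between $(x,y)$ and $(x,y+1)$ is kept exactly when $x+y$ is odd. In a partially oriented version each horizontal edge is given one direction and vertical edges can be traversed both ways, so every vertex has exactly two outgoing edges (one horizontal, one vertical). The simple random walk $(M_n)_{n\ge0}$ starts at $(0,0)$ and at each step follows one of the two outgoing edges of its current vertex with probability $1/2$ each, independently of the past. For a given orientation, the walk is transient if $\sum_{l\ge 0}\mathbb{P}_0(M_l=(0,0))<\infty$ and recurrent if this sum is infinite (equivalently, if the walk returns to the origin infinitely often almost surely). *)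

(* Defs.v *)
From HB Require Import structures.
From mathcomp Require Import all_boot all_order all_algebra.
From mathcomp Require Import all_classical all_reals all_analysis.

Set Implicit Arguments.
Unset Strict Implicit.
Unset Printing Implicit Defensive.

Import Order.TTheory GRing.Theory Num.Theory.

Local Open Scope classical_set_scope.
Local Open Scope ring_scope.

Definition vertex : Type := (int * int)%type.

Definition origin : vertex := (0, 0).

(* The vertical edge between (x, y) and (x, y + 1) belongs to the honeycomb
   lattice exactly when x + y is odd. *)
Definition vertical_edge (x y : int) : bool := ~~ (2 %| x + y)%Z.

(* [arc e u v]: there is an outgoing edge from u to v in the honeycomb lattice
   whose line at height y is directed to the right when e y = 1 and to the left
   when e y = -1.  Vertical edges are traversed both ways. *)
Definition arc (R : realType) (e : int -> R) (u v : vertex) : bool :=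
  [|| (e u.2 == 1) && (v == (u.1 + 1, u.2)),
      (e u.2 == -1) && (u == (v.1 + 1, v.2)),
      vertical_edge u.1 u.2 && (v == (u.1, u.2 + 1))
    | vertical_edge v.1 v.2 && (u == (v.1, v.2 + 1))].

Definition step_prob (R : realType) (e : int -> R) (u v : vertex) : R :=
  if arc e u v then 2^-1 else 0.

(* Simple random walk from the origin: the chain rule below is the condition
   Q(M_{n+1} = x_{n+1} | M_0 = x_0, ..., M_n = x_n) = step_prob e x_n x_{n+1},
   multiplied by the probability of the conditioning event. *)
Definition simple_random_walk (R : realType) (e : int -> R)
    (d : measure_display) (T : measurableType d) (Q : probability T R)
    (M : nat -> T -> vertex) : Prop :=
  [/\ forall n v, measurable [set t | M n t = v],
      Q [set t | M 0%N t = origin] = 1%E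
    & forall (n : nat) (x : nat -> vertex),
        Q [set t | forall i : nat, (i <= n.+1)%N -> M i t = x i] =
        (Q [set t | forall i : nat, (i <= n)%N -> M i t = x i]
         * (step_prob e (x n) (x n.+1))%:E)%E].

(* The law of the walk is determined by e, so the quantification over its
   realizations (T, Q, M) expresses a property of the orientation e alone. *)
Definition transient (R : realType) (e : int -> R) : Prop :=
  forall (d : measure_display) (T : measurableType d) (Q : probability T R)
    (M : nat -> T -> vertex),
  simple_random_walk e Q M ->
  (\sum_(0 <= l <oo) Q [set t | M l t = origin] < +oo)%E.

Definition rademacher (R : realType) (d : measure_display)
    (T : measurableType d) (P : probability T R) (X : {RV P >-> R}) : Prop :=
  [/\ forall w, X w = -1 \/ X w = 1,
      P [set w | X w = 1] = (2^-1)%:E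
    & P [set w | X w = -1] = (2^-1)%:E].

Definition mutually_independent (R : realType) (d : measure_display)
    (T : measurableType d) (P : probability T R) (I : choiceType)
    (X : I -> {RV P >-> R}) : Prop :=
  forall (J : seq I) (B : I -> set R),
    uniq J -> (forall i, measurable (B i)) ->
    P [set w | forall i, i \in J -> B i (X i w)] =
    (\prod_(i <- J) P (X i @^-1` B i))%E.

(* Main.v *)
(* Every step changes the parity of x + y, and the vertical edge at (x, y) leads
   down when x + y is even and up when it is odd. Grouping the steps of the walk
   in pairs, the height becomes a lazy simple random walk Z, and the abscissa
   after n pairs is S + V with S = \sum_(i < n) eps (l_i), where l_i is the line
   used by the i-th pair (a function of Z alone), and where, given Z, V is a
   simple random walk of K steps, K being the number of pairs that do not change
   the height: by symmetry its law does not depend on eps.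

   A return at time 2n requires Z_n = 0, with probability O(n^(-1/2)) uniformly
   in the first half of the path, and V = -S. As P(V = v | Z) is at most
   min(C K^(-1/2), 1 / (|v| + 1)), the latter costs another O(n^(-1/2)) and
   essentially forces |S| <= n^(1/2 + delta). By the Littlewood-Offord inequality
   applied to S = \sum_y eps_y A_y, with A_y the occupation numbers of Z, this
   has probability O(n^(-c)) over eps as soon as sufficiently many lines have
   A_y >= n^(1/2 - delta); first and second moments of the occupation numbers
   show that this fails with probability O(n^(-c)) only. So the return
   probability averaged over eps is O(n^(-1 - c)), which is summable. *)
Require Import Defs.
From mathcomp Require Import all_boot all_order all_algebra.
From mathcomp Require Import all_classical all_reals all_analysis.
From mathcomp Require Import measurable_realfun ring lra zify.

Set Implicit Arguments.
Unset Strict Implicit.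
Unset Printing Implicit Defensive.

Import Order.TTheory GRing.Theory Num.Theory.

Local Open Scope ring_scope.

(** * Averages over independent draws *)

Section Average.
Variables (R : realFieldType).
Implicit Types (T : Type).

(* The expectation of [f] over [n] independent draws from the finite law [mu],
   given as a list of pairs (weight, value). *)
Fixpoint avg T (mu : seq (R * T)) (n : nat) (f : seq T -> R) : R :=
  if n is m.+1 then \sum_(p <- mu) p.1 * avg mu m (fun s => f (p.2 :: s))
  else f [::].

Definition distribution T (mu : seq (R * T)) : Prop :=
  all (fun p => 0 <= p.1) mu /\ \sum_(p <- mu) p.1 = 1.

Lemma eq_avg T (mu : seq (R * T)) n f g : f =1 g -> avg mu n f = avg mu n g.
Proof.
elim: n f g => [|n IH] f g fg /=; first exact: fg.
by apply: eq_bigr => p _; congr (_ * _); apply: IH => s; exact: fg.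
Qed.

Lemma le_avg (T : eqType) (mu : seq (R * T)) n f g : distribution mu ->
    (forall s, size s = n -> {subset s <= map snd mu} -> f s <= g s) ->
  avg mu n f <= avg mu n g.
Proof.
move=> [mu0 mu1]; elim: n f g => [|n IH] f g fg /=; first exact: fg.
rewrite big_seq [leRHS]big_seq; apply: ler_sum => p pmu.
apply: ler_wpM2l; first by move/allP: mu0 => /(_ p pmu).
apply: IH => s ss smu; apply: fg => /=; first by rewrite ss.
move=> x; rewrite inE => /orP[/eqP ->|/smu //].
by apply/mapP; exists p.
Qed.

Lemma avgD T (mu : seq (R * T)) n f g :
  avg mu n (fun s => f s + g s) = avg mu n f + avg mu n g.
Proof.
elim: n f g => [|n IH] f g //=.
by rewrite -big_split /=; apply: eq_bigr => p _; rewrite IH mulrDr.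
Qed.

Lemma avgZ T (mu : seq (R * T)) n c f :
  avg mu n (fun s => c * f s) = c * avg mu n f.
Proof.
elim: n f => [|n IH] f //=.
by rewrite big_distrr /=; apply: eq_bigr => p _; rewrite IH mulrCA.
Qed.

Lemma avg_sum T (mu : seq (R * T)) n (I : Type) (r : seq I) f :
  avg mu n (fun s => \sum_(i <- r) f i s) = \sum_(i <- r) avg mu n (f i).
Proof.
elim: r => [|i r IH].
  rewrite big_nil -[RHS](mul0r (avg mu n (fun=> 0))) -avgZ.
  by apply: eq_avg => s; rewrite big_nil mul0r.
by rewrite big_cons -IH -avgD; apply: eq_avg => s; rewrite big_cons.
Qed.

Lemma avg_cst (T : eqType) (mu : seq (R * T)) n c : distribution mu ->
  avg mu n (fun=> c) = c.
Proof.
move=> [_ mu1]; elim: n => //= n ->.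
by rewrite -big_distrl /= mu1 mul1r.
Qed.

Lemma avg_cat T (mu : seq (R * T)) n m f :
  avg mu (n + m) f = avg mu n (fun s => avg mu m (fun t => f (s ++ t))).
Proof.
elim: n f => [|n IH] f //=.
by apply: eq_bigr => p _; rewrite IH.
Qed.

Lemma avg_rcons T (mu : seq (R * T)) n f :
  avg mu n.+1 f = avg mu n (fun s => \sum_(p <- mu) p.1 * f (rcons s p.2)).
Proof.
rewrite -addn1 avg_cat /=; apply: eq_avg => s.
by apply: eq_bigr => p _; rewrite cats1.
Qed.

Lemma avg_exchange T T' (mu : seq (R * T)) (nu : seq (R * T')) n m f :
  avg mu n (fun s => avg nu m (f s)) =
  avg nu m (fun t => avg mu n (fun s => f s t)).
Proof.
elim: n f => [|n IH] f //=.
rewrite avg_sum; apply: eq_bigr => p _.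
by rewrite IH avgZ.
Qed.

Lemma avg_ge0 (T : eqType) (mu : seq (R * T)) n f : distribution mu ->
  (forall s, 0 <= f s) -> 0 <= avg mu n f.
Proof.
move=> mud f0; rewrite -(avg_cst n 0 mud).
by apply: le_avg.
Qed.

Definition signs : seq (R * int) := [:: (2^-1, 1); (2^-1, -1)].
(** The height increment over two steps from a vertex with [x + y] even: two horizontal or two
    vertical steps give 0, horizontal then vertical gives 1, vertical then horizontal gives -1. *)
Definition lazy_steps : seq (R * int) := [:: (2^-1, 0); (4^-1, 1); (4^-1, -1)].

Lemma signs_distribution : distribution signs.
Proof.
by split; [rewrite /= !invr_ge0 !ler0n|rewrite !big_cons big_nil /=; field].
Qed.

Lemma lazy_distribution : distribution lazy_steps.
Proof.
by split; [rewrite /= !invr_ge0 !ler0n|rewrite !big_cons big_nil /=; field].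
Qed.

Lemma avg_signsS n f : avg signs n.+1 f =
  (avg signs n (fun s => f (1 :: s)) + avg signs n (fun s => f (-1 :: s))) / 2.
Proof. by rewrite /= !big_cons big_nil /=; ring. Qed.

Lemma avg_lazyS n f : avg lazy_steps n.+1 f =
  2^-1 * avg lazy_steps n (fun s => f (0 :: s)) +
  4^-1 * (avg lazy_steps n (fun s => f (1 :: s))
          + avg lazy_steps n (fun s => f (-1 :: s))).
Proof. by rewrite /= !big_cons big_nil /=; ring. Qed.

Lemma avg_lazy_rcons n f : avg lazy_steps n.+1 f =
  avg lazy_steps n (fun s => 2^-1 * f (rcons s 0) +
     4^-1 * (f (rcons s 1) + f (rcons s (-1)))).
Proof.
rewrite avg_rcons; apply: eq_avg => s.
by rewrite !big_cons big_nil /=; ring.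
Qed.

End Average.
Arguments signs {R}.
Arguments lazy_steps {R}.
Arguments signs_distribution {R}.
Arguments lazy_distribution {R}.

(** * The law of the simple random walk *)

Section SRW.
Variable R : realFieldType.

(* The probability that [k] fair signs sum to [v]. *)
Fixpoint srw (k : nat) (v : int) : R :=
  if k is k'.+1 then (srw k' (v - 1) + srw k' (v + 1)) / 2 else (v == 0)%:R.

Lemma srw_ge0 k v : 0 <= srw k v.
Proof.
elim: k v => [|k IH] v /=; first exact: ler0n.
by have := IH (v - 1); have := IH (v + 1); lra.
Qed.

Lemma srwN k v : srw k (- v) = srw k v.
Proof.
elim: k v => [|k IH] v /=; first by rewrite oppr_eq0.
have -> : - v - 1 = - (v + 1) by ring.
have -> : - v + 1 = - (v - 1) by ring.
by rewrite !IH addrC.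
Qed.

(** The range includes [-1], where symmetry gives equality, because the induction at [v = 0] appeals
    to [v - 1]. *)
Lemma srw_unimodal k v : -1 <= v -> srw k (v + 2) <= srw k v.
Proof.
elim: k v => [|k IH] v v1 /=.
  by rewrite ler_nat; case: eqP => // ?; lia.
have -> : v + 2 - 1 = v + 1 by ring.
have [v0|v0] := leP 0 v; last first.
  have -> : v = -1 by lia.
  by rewrite addrC -(srwN _ (-1 - 1)).
have := IH (v - 1) ltac:(lia); have := IH (v + 1) ltac:(lia).
have -> : v + 1 + 2 = v + 2 + 1 by ring.
have -> : v - 1 + 2 = v + 1 by ring.
lra.
Qed.

Lemma srw_le_addl k (w : int) (j : nat) : 0 <= w ->
  srw k (w + 2 * j%:Z) <= srw k w.
Proof.
move=> w0; elim: j => [|j IH]; first by rewrite mulr0 addr0.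
apply: le_trans IH.
have -> : w + 2 * j.+1%:Z = w + 2 * j%:Z + 2 by lia.
by apply: srw_unimodal; lia.
Qed.

(** [v - 2 * i] has the parity of [v] and lies between [- v] and [v], so it is no farther from the
    centre. *)
Lemma srw_unimodalN k v (i : nat) : 0 <= v -> (i%:Z <= v)%R ->
  srw k v <= srw k (v - 2 * i%:Z).
Proof.
move=> v0.
move=> iv; have [iv2|iv2] := leP (2 * i%:Z) v.
  by have := @srw_le_addl k (v - 2 * i%:Z) i ltac:(lia); rewrite subrK.
rewrite -[leRHS]srwN opprB.
have -> : 2 * i%:Z - v = v - 2 * `|v - i%:Z|%N%:Z by lia.
have := @srw_le_addl k (v - 2 * `|v - i%:Z|%N%:Z) `|v - i%:Z|%N ltac:(lia).
by rewrite subrK.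
Qed.

Lemma srw_sum_le1 k (v : int) (n : nat) :
  \sum_(i < n) srw k (v - 2 * i%:Z) <= 1.
Proof.
elim: k v => [|k IH] v /=.
  elim: n v => [|n IHn] v; first by rewrite big_ord0.
  rewrite big_ord_recl /= mulr0 subr0.
  case: eqP => [->|_].
    by rewrite big1 ?addr0.
  rewrite add0r; apply: le_trans (IHn (v - 2)); apply: ler_sum => i _.
  rewrite /bump /= ler_nat.
  have -> : v - 2 * (1 + i)%N%:Z = v - 2 - 2 * i%:Z by lia.
  by [].
rewrite -big_distrl /= big_split /=.
have e1 : \sum_(i < n) srw k (v - 2 * i%:Z - 1) <= 1.
  by under eq_bigr => i _ do rewrite addrAC; exact: IH.
have e2 : \sum_(i < n) srw k (v - 2 * i%:Z + 1) <= 1.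
  by under eq_bigr => i _ do rewrite addrAC; exact: IH.
lra.
Qed.

(** For [0 <= v], the [v + 1] points [v], [v - 2], ..., [- v] are each at least as likely as [v],
    and their total mass is at most 1. *)
Lemma srw_le_inv k v : (`|v|%:~R + 1) * srw k v <= 1.
Proof.
wlog v0 : v / 0 <= v => [H|].
  have [/H //|v0] := leP 0 v.
  by have := H (- v) ltac:(lia); rewrite srwN normrN.
have -> : `|v|%:~R + 1 = (`|v|%N.+1)%:R :> R.
  by rewrite -natr1 natr_absz.
apply: le_trans (srw_sum_le1 k v `|v|%N.+1).
rewrite mulr_natl -[X in _ *+ X](card_ord `|v|%N.+1) -sumr_const.
apply: ler_sum => i _; apply: srw_unimodalN => //.
by have := ltn_ord i; lia.
Qed.

(** Exchangeability in disguise: given that [k.+1] fair signs sum to [v], each of them has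
    conditional mean [v / k.+1]. *)
Lemma srw_drift k v :
  v%:~R * srw k.+1 v = k.+1%:R / 2 * (srw k (v - 1) - srw k (v + 1)).
Proof.
elim: k v => [|k IH] v.
  rewrite /= -!mulrA; have [->|v0] := eqVneq v 1; first by rewrite subrr /=; field.
  have [->|v1] := eqVneq v (-1); first by rewrite addNr /=; field.
  have -> : (v - 1 == 0) = false by lia.
  have -> : (v + 1 == 0) = false by lia.
  by rewrite /=; field.
have e1 := IH (v - 1); have e2 := IH (v + 1).
have h1 : srw k.+1 (v - 1) = (srw k (v - 1 - 1) + srw k (v - 1 + 1)) / 2 by [].
have h2 : srw k.+1 (v + 1) = (srw k (v + 1 - 1) + srw k (v + 1 + 1)) / 2 by [].
have -> : srw k.+2 v = (srw k.+1 (v - 1) + srw k.+1 (v + 1)) / 2 by [].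
move: e1 e2 h1 h2; rewrite intrB intrD !addrK  -[k.+2%:R]natr1.
move: (srw k.+1 (v - 1)) (srw k.+1 (v + 1)) (srw k (v - 1 - 1)).
move: (srw k v) (srw k (v + 1 + 1)).
move=> e g a b c; move: (v%:~R : R) (k.+1%:R : R) => V N e1 e2 h1 h2.
have E1 : V * a = a + N / 2 * (c - e) by rewrite -e1; ring.
have E2 : V * b = N / 2 * (e - g) - b by rewrite -e2; ring.
have -> : V * ((a + b) / 2) = (V * a + V * b) / 2 by ring.
by rewrite E1 E2 h1 h2; field.
Qed.

(** The ratio of consecutive central binomial probabilities, obtained from [srw_drift] at [v = 1]
    without factorials. *)
Lemma srw_centerS n :
  (2 * n.+1)%:R * srw (2 * n.+1) 0 = (2 * n).+1%:R * srw (2 * n) 0.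
Proof.
have e1 := srw_drift (2 * n) 1.
have -> : (2 * n.+1 = (2 * n).+2)%N by lia.
have h1 : srw (2 * n).+1 1 = (srw (2 * n) 0 + srw (2 * n) 2) / 2 by [].
have h2 : srw (2 * n).+2 0 = srw (2 * n).+1 1.
  rewrite -[LHS]/((srw (2 * n).+1 (-1) + srw (2 * n).+1 1) / 2) srwN; lra.
move: e1; rewrite subrr -[1 + 1]/(2 : int) h2 mul1r -[X in X * _ = _]natr1.
move: (srw (2 * n).+1 1) (srw (2 * n) 0) (srw (2 * n) 2) h1.
move: (((2 * n).+1)%:R : R) => N a b c h1 e1.
have ec : c = 2 * a - b by lra.
by rewrite mulrDl mul1r {2}e1 ec; field.
Qed.

(** By [srw_centerS] the left side is nonincreasing in [n], since
    [(2n + 1)(2n + 3) <= (2n + 2)^2]. *)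
Lemma srw_center_sqr n : srw (2 * n) 0 ^+ 2 * (2 * n).+1%:R <= 1.
Proof.
elim: n => [|n IH]; first by rewrite muln0 /= expr1n mul1r.
have e := srw_centerS n; have p := srw_ge0 (2 * n.+1) 0.
have E1 : (2 * n.+1)%:R = 2 * (n%:R + 1) :> R by rewrite natrM -[n.+1%:R]natr1.
have E2 : (2 * n).+1%:R = 2 * n%:R + 1 :> R by rewrite -[LHS]natr1 natrM.
have E3 : (2 * n.+1).+1%:R = 2 * (n%:R + 1) + 1 :> R by rewrite -[LHS]natr1 E1.
move: IH e p; rewrite E1 E2 E3 => {E1 E2 E3}.
have : 0 <= (n%:R : R) by [].
move: (n%:R : R) (srw (2 * n) 0) (srw (2 * n.+1) 0) => N a c N0 IH e p.
have e2 : (2 * (N + 1)) ^+ 2 * c ^+ 2 = (2 * N + 1) ^+ 2 * a ^+ 2.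
  by rewrite -!exprMn e.
have h : (2 * (N + 1)) ^+ 2 * (c ^+ 2 * (2 * (N + 1) + 1)) <= (2 * (N + 1)) ^+ 2.
  rewrite mulrA e2.
  have -> : (2 * N + 1) ^+ 2 * a ^+ 2 * (2 * (N + 1) + 1) =
    (a ^+ 2 * (2 * N + 1)) * ((2 * N + 1) * (2 * (N + 1) + 1)) by ring.
  apply: le_trans (_ : 1 * ((2 * N + 1) * (2 * (N + 1) + 1)) <= _).
    by apply: ler_wpM2r IH; apply: mulr_ge0; lra.
  nra.
by move: h; rewrite -[leRHS]mulr1 ler_pM2l // exprn_gt0 //; lra.
Qed.

Lemma srw_even_max n v : srw (2 * n) v <= srw (2 * n) 0.
Proof.
wlog v0 : v / 0 <= v => [H|].
  have [/H //|v0] := leP 0 v.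
  by have := H (- v) ltac:(lia); rewrite srwN.
have odd0 k (w : int) : srw k (2 * w + k%:Z + 1) = 0.
  elim: k w => [|k IHk] w /=; first by rewrite (_ : (_ == 0) = false) //; lia.
  have -> : 2 * w + k.+1%:Z + 1 - 1 = 2 * w + k%:Z + 1 by lia.
  have -> : 2 * w + k.+1%:Z + 1 + 1 = 2 * (w + 1) + k%:Z + 1 by lia.
  by rewrite !IHk addr0 mul0r.
have [e|e] : v = 0 + 2 * (`|v|./2)%N%:Z \/
    v = 2 * ((`|v|./2)%N%:Z - n%:Z) + (2 * n)%N%:Z + 1 by lia.
  by rewrite e; apply: srw_le_addl.
by rewrite e odd0 srw_ge0.
Qed.

Lemma srw_even_sqr n v : srw (2 * n) v ^+ 2 * (2 * n).+1%:R <= 1.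
Proof.
apply: le_trans (srw_center_sqr n); apply: ler_wpM2r => //.
by rewrite ler_pXn2r ?nnegrE ?srw_ge0 ?srw_even_max.
Qed.

(** At odd times [srw] is the mean of two values at the preceding even time, so convexity of the
    square applies; passing from [k] to [k.+1] costs the factor 2. *)
Lemma srw_sqr k v : srw k v ^+ 2 * k.+1%:R <= 2.
Proof.
have [n [e|e]] : exists n, k = (2 * n)%N \/ k = (2 * n).+1 by exists k./2; lia.
  by rewrite e; have := srw_even_sqr n v; lra.
rewrite e /=; move: (srw_even_sqr n (v - 1)) (srw_even_sqr n (v + 1)).
have -> : (2 * n).+2%:R = (2 * n).+1%:R + 1 :> R by rewrite -natr1.
have : 1 <= (2 * n).+1%:R :> R by rewrite ler1n.
move: (srw _ (v - 1)) (srw _ (v + 1)) ((2 * n).+1%:R : R) => a b N N1 ha hb.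
have h : ((a + b) / 2) ^+ 2 * N <= 1.
  have -> : ((a + b) / 2) ^+ 2 * N =
    (a ^+ 2 * N + b ^+ 2 * N) / 2 - ((a - b) / 2) ^+ 2 * N by field.
  have : 0 <= ((a - b) / 2) ^+ 2 * N by apply: mulr_ge0; [exact: sqr_ge0|lra].
  lra.
apply: le_trans (_ : ((a + b) / 2) ^+ 2 * (N * 2) <= 2); last by lra.
by apply: ler_wpM2l; [exact: sqr_ge0|lra].
Qed.

Lemma srw_center_sum m :
  \sum_(j < m) srw (2 * j) 0 = (2 * m)%:R * srw (2 * m) 0.
Proof.
elim: m => [|m IH]; first by rewrite big_ord0 muln0 mul0r.
by rewrite big_ord_recr /= IH srw_centerS -natr1 mulrDl mul1r.
Qed.

(** A lazy step is distributed as half the sum of two fair signs. *)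
Lemma lazy_pmf n y : avg lazy_steps n (fun s => (y + \sum_(d <- s) d == 0)%:R)
  = srw (2 * n) (2 * y).
Proof.
elim: n y => [|n IH] y.
  by rewrite muln0 /= big_nil addr0 mulf_eq0.
rewrite avg_lazyS.
have e (d : int) : avg lazy_steps n (fun s => (y + \sum_(i <- d :: s) i == 0)%:R) =
    srw (2 * n) (2 * (y + d)).
  by rewrite -IH; apply: eq_avg => s; rewrite big_cons addrA.
rewrite !e addr0 (_ : (2 * n.+1 = (2 * n).+2)%N) /=; last by lia.
have -> : 2 * y - 1 - 1 = 2 * (y + -1) by ring.
have -> : 2 * y - 1 + 1 = 2 * y by ring.
have -> : 2 * y + 1 - 1 = 2 * y by ring.
have -> : 2 * y + 1 + 1 = 2 * (y + 1) by ring.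
by field.
Qed.

End SRW.

(** * A Littlewood-Offord inequality *)

Section LittlewoodOfford.
Variable R : realFieldType.

Definition dot (c A : seq int) : int := \sum_(p <- zip c A) p.1 * p.2.

Lemma dot_cons e c a A : dot (e :: c) (a :: A) = e * a + dot c A.
Proof. by rewrite /dot big_cons. Qed.

(** [xs] lists the left ends of half-open blocks. Their length is [2 * L] so that the shifts of a
    block by [a] and by [- a] are disjoint as soon as [L <= a]. *)
Definition hits (L : int) (xs : seq int) (S : int) : R :=
  \sum_(x <- xs) (x <= S < x + 2 * L)%R%:R.

Lemma hits_shift L xs a S :
  hits L xs (a + S) = hits L [seq x - a | x <- xs] S.
Proof.
rewrite /hits big_map; apply: eq_bigr => x _.
by congr (nat_of_bool _)%:R; apply/idP/idP => /andP[h1 h2]; apply/andP; split; lia.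
Qed.

Definition separated (L : int) : rel int := fun x y => x + 2 * L <= y.

(* The probability that a simple random walk started at [r] is positive at the
   times [0], ..., [N]. *)
Fixpoint survival (N r : nat) : R :=
  if r is r'.+1 then
    if N is N'.+1 then (survival N' r'.+2 + survival N' r') / 2 else 1
  else 0.

Lemma survival_le1 N r : survival N r <= 1.
Proof.
elim: N r => [|N IH] [|r] //=.
by have := IH r.+2; have := IH r; lra.
Qed.

(** After division by [N * M]: a surviving walk either reaches [M] before 0, with probability
    [r / M], or stays strictly between 0 and [M] up to time [N], which Markov's inequality bounds
    through the mean exit time [r * (M - r)]. *)
Lemma survival_potential (M N r : nat) : (r <= M)%N ->
  N%:R * survival N r * M%:R <= N%:R * r%:R + r%:R * (M%:R - r%:R) * M%:R.
Proof.
elim: N r => [|N IH] [|r] rM /=; rewrite ?mulr0 ?mul0r ?addr0 //.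
  rewrite add0r; apply: mulr_ge0 => //; apply: mulr_ge0 => //.
  by rewrite subr_ge0 ler_nat.
have [rM'|] := ltnP r.+1 M; last first.
  move=> Mr; have -> : M = r.+1 by lia.
  rewrite subrr mulr0 mul0r addr0; apply: ler_wpM2r => //.
  rewrite -[leRHS]mulr1; apply: ler_wpM2l => //.
  by have := survival_le1 N r.+2; have := survival_le1 N r; lra.
have h1 := IH r.+2 rM'; have h2 := IH r ltac:(lia).
have s1 := survival_le1 N r.+2; have s2 := survival_le1 N r.
have M0 : 0 <= M%:R :> R by [].
have er : r.+2%:R = r%:R + 2 :> R by rewrite -addn2 natrD.
have er1 : r.+1%:R = r%:R + 1 :> R by rewrite -natr1.
rewrite er1 -[N.+1%:R]natr1; rewrite er in h1.
have M1 : (survival N r.+2 + survival N r) / 2 * M%:R <= M%:R.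
  by rewrite -[leRHS]mul1r; apply: ler_wpM2r => //; lra.
have r0 : 0 <= r%:R :> R by [].
lra.
Qed.

Lemma survival_bound (M N r : nat) : (0 < M)%N -> (M * M <= N)%N ->
  survival N r <= 2 * r%:R / M%:R.
Proof.
move=> M0 MN; have M0' : 0 < M%:R :> R by rewrite ltr0n.
rewrite ler_pdivlMr //.
have [rM|Mr] := leqP r M; last first.
  have h : M%:R <= r%:R :> R by rewrite ler_nat ltnW.
  have := survival_le1 N r => /(ler_wpM2r (ltW M0')); lra.
have N0 : 0 < N%:R :> R by rewrite ltr0n; apply: leq_trans MN; rewrite muln_gt0 M0.
rewrite -(ler_pM2l N0) mulrA; apply: le_trans (survival_potential N rM) _.
have MN' : M%:R * M%:R <= N%:R :> R by rewrite -natrM ler_nat.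
have r0 : 0 <= r%:R :> R by [].
have : r%:R * (M%:R - r%:R) * M%:R <= r%:R * N%:R :> R.
  rewrite -mulrA; apply: ler_wpM2l => //; apply: le_trans MN'.
  by apply: ler_wpM2r; [exact: ltW|lra].
lra.
Qed.

Lemma hits_separated_le1 (L : int) (xs : seq int) (S : int) : 0 < L ->
  sorted (separated L) xs -> hits L xs S <= 1.
Proof.
move=> L0; elim: xs => [|x xs IH]; first by rewrite /hits big_nil.
have miss : forall ys y, path (separated L) y ys -> S < y + 2 * L ->
    hits L ys S = 0.
  elim=> [|z zs IHz] y; first by rewrite /hits big_nil.
  rewrite /= /separated => /andP[yz pz] Sy; rewrite /hits big_cons.
  have zS : S < z by lia.
  rewrite leNgt zS add0r -/(hits L zs S).
  by apply: IHz pz _; lia.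
move=> pxs; rewrite /hits big_cons -/(hits L xs S).
have [Sx|Sx] := ltP S (x + 2 * L).
  by rewrite (miss _ _ pxs Sx) addr0 lern1 leq_b1.
by rewrite andbF add0r; apply: IH; apply: path_sorted pxs.
Qed.

(* When [a >= L], the first block of [xs - a] lies to the left of all blocks of
   [xs + a]; moving it there turns r + r blocks into (r + 1) + (r - 1). *)
Lemma littlewood_offord (L : int) (A xs : seq int) : 0 < L ->
    sorted (separated L) xs ->
  avg signs (size A) (fun c => hits L xs (dot c A))
    <= survival (count (fun a => L <= a) A) (size xs).
Proof.
move=> L0; have str : transitive (separated L).
  by rewrite /separated => y x z; lia.
have shift_sorted xs' a : sorted (separated L) xs' ->
    sorted (separated L) [seq x - a | x <- xs'].
  rewrite sorted_map; apply: sub_sorted => x y; rewrite /separated /=; lia.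
elim: A xs => [|a A IH] xs sxs.
  rewrite /=; case: xs sxs => [|x xs] sxs; first by rewrite /hits big_nil.
  exact: hits_separated_le1.
rewrite -[size (a :: A)]/(size A).+1 avg_signsS.
under eq_avg => c do rewrite dot_cons mul1r hits_shift.
under [X in (_ + X) / 2]eq_avg => c do rewrite dot_cons mulN1r hits_shift.
rewrite -[count _ (a :: A)]/((L <= a)%R + count (fun a => L <= a)%R A)%N.
(* A weight below [L] is not counted: either sign merely translates the blocks. *)
have [La|La] := leP L a; last first.
  have h1 := IH _ (shift_sorted xs a sxs); have h2 := IH _ (shift_sorted xs (- a) sxs).
  rewrite !size_map in h1 h2; rewrite add0n; lra.
case: xs sxs => [|x xs] sxs.
  rewrite /hits.
  under eq_avg => c do rewrite big_nil.
  by rewrite avg_cst ?addr0 ?mul0r //; exact: signs_distribution.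
have := IH [seq y - a | y <- xs] (shift_sorted _ a (path_sorted sxs)).
have := IH (x - a :: [seq y - - a | y <- x :: xs]).
have -> : sorted (separated L) (x - a :: [seq y - - a | y <- x :: xs]).
  have := shift_sorted _ (- a) sxs; rewrite /= => ->.
  by rewrite andbT /separated; lia.
rewrite /= !size_map => /(_ isT) h1 h2.
suff -> : avg signs (size A) (fun c => hits L [seq y - a | y <- x :: xs] (dot c A)) +
    avg signs (size A) (fun c => hits L [seq y - - a | y <- x :: xs] (dot c A)) =
  avg signs (size A)
      (fun c => hits L (x - a :: [seq y - - a | y <- x :: xs]) (dot c A)) +
    avg signs (size A) (fun c => hits L [seq y - a | y <- xs] (dot c A)) :> R.
  by move: h1 h2; rewrite /=; lra.
rewrite -!avgD; apply: eq_avg => c; rewrite /hits /= !big_cons; ring.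
Qed.

(** [r] adjacent blocks starting at [- T] cover the interval from [- T] to [T], so the probability
    is at most the mean number of hits. *)
Lemma small_ball (L T : int) (A : seq int) (r M : nat) : 0 < L ->
    (0 < M)%N -> 2 * T + 1 <= 2 * L * r%:Z ->
    (M * M <= count (fun a => L <= a)%R A)%N ->
  avg signs (size A) (fun c => (`|dot c A| <= T)%R%:R) <= 2 * r%:R / M%:R :> R.
Proof.
move=> L0 M0 Tr MA.
pose xs := [seq - T + 2 * L * i%:Z | i <- iota 0 r].
have sxs : sorted (separated L) xs.
  rewrite sorted_map; apply: sub_sorted (iota_ltn_sorted 0 r).
  by move=> i j; rewrite /separated /=; nia.
apply: le_trans (survival_bound r M0 MA).
have := littlewood_offord A L0 sxs; rewrite size_map size_iota.
apply: le_trans; apply: le_avg signs_distribution _ => c _ _.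
have [|//] := leP `|dot c A| T; last by move=> _; apply: sumr_ge0.
move: (dot c A) => S ST; rewrite /hits /xs big_map.
pose i := `|((S + T) %/ (2 * L))%Z|%N.
have i0 : 0 <= ((S + T) %/ (2 * L))%Z by rewrite divz_ge0; lia.
have iE : i%:Z = ((S + T) %/ (2 * L))%Z by rewrite /i gez0_abs.
have e := divz_eq (S + T) (2 * L).
have m0 := modz_ge0 (S + T) (d := 2 * L) ltac:(lia).
have m1 := ltz_pmod (S + T) (d := 2 * L) ltac:(lia).
have ir : i \in iota 0 r by rewrite mem_iota /=; nia.
rewrite (bigD1_seq i) ?iota_uniq //=.
have -> : (- T + 2 * L * i%:Z <= S < - T + 2 * L * i%:Z + 2 * L)%R.
  by rewrite iE; apply/andP; split; lia.
by rewrite lerDl; apply: sumr_ge0.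
Qed.

End LittlewoodOfford.

(** * Occupation of the horizontal lines *)

Section Levels.
Variable R : realFieldType.

(* The horizontal line used by a pair of steps that adds [d] to the height [y]:
   the edge between two neighbouring heights is accounted to the lower one. *)
Definition line (y d : int) : int := if d == -1 then y - 1 else y.

Fixpoint lines (y : int) (s : seq int) : seq int :=
  if s is d :: s' then line y d :: lines (y + d) s' else [::].

Lemma size_lines y s : size (lines y s) = size s.
Proof. by elim: s y => //= d s IH y; rewrite IH. Qed.

Lemma lines_cat y s t :
  lines y (s ++ t) = lines y s ++ lines (y + \sum_(d <- s) d) t.
Proof.
elim: s y => [|d s IH] y /=; first by rewrite big_nil addr0.
by rewrite IH big_cons addrA.
Qed.

Lemma lines_bounded y s (b : int) : {subset s <= [:: 0; 1; -1 : int]} ->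
  `|y| + (size s)%:Z <= b -> {in lines y s, forall l, `|l| <= b}.
Proof.
elim: s y => [|d s IH] y // sub.
rewrite -[size (d :: s)]/(size s).+1 => yb l; rewrite inE.
have d1 : `|d| <= 1 /\ `|line y d| <= b.
  have : d \in [:: 0; 1; -1 : int] by apply: sub; rewrite mem_head.
  by rewrite !inE /line => /or3P[] /eqP -> /=; lia.
case/orP => [/eqP ->|]; first by case: d1.
apply: IH; last by lia.
by move=> x xs; apply: sub; rewrite inE xs orbT.
Qed.

(** A pair uses line [z] only if it starts at height [z], or at [z + 1] and goes down; after [j]
    pairs each has probability at most [srw R (2 * j) 0]. *)
Lemma avg_count_lines (z y : int) m :
  avg lazy_steps m (fun s => (count_mem z (lines y s))%:R) <=
  2 * \sum_(j < m) srw R (2 * j) 0.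
Proof.
elim: m => [|m IH]; first by rewrite /= big_ord0 mulr0.
rewrite avg_lazy_rcons big_ord_recr /= mulrDr.
apply: le_trans (lerD IH (lexx _)).
have -> : 2 * srw R (2 * m) 0 = srw R (2 * m) 0 + srw R (2 * m) 0 by ring.
apply: le_trans (lerD (lexx _) (lerD (srw_even_max _ m (2 * (y - z)))
   (srw_even_max _ m (2 * (y - z - 1))))).
rewrite -!lazy_pmf -!avgD; apply: le_avg lazy_distribution _ => s _ _.
rewrite -!cats1 !lines_cat !count_cat !natrD /= /line /= !addr0.
have -> : (y - z + \sum_(d <- s) d == 0) = (y + \sum_(d <- s) d == z) by lia.
have -> : (y - z - 1 + \sum_(d <- s) d == 0) = (y + \sum_(d <- s) d - 1 == z) by lia.
have : 0 <= (y + \sum_(d <- s) d - 1 == z)%:R :> R by [].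
have : 0 <= (y + \sum_(d <- s) d == z)%:R :> R by [].
lra.
Qed.

(* The sum of the squares of the occupation numbers. *)
Definition collisions (ls : seq int) : nat := \sum_(l <- ls) count_mem l ls.

Lemma collisions_cons l ls :
  collisions (l :: ls) = (1 + 2 * count_mem l ls + collisions ls)%N.
Proof.
rewrite /collisions big_cons /= eqxx.
have -> : (\sum_(j <- ls) ((l == j) + count_mem j ls) =
   count_mem l ls + \sum_(j <- ls) count_mem j ls)%N.
  rewrite big_split /=; congr addn.
  by rewrite -sum1_count -big_mkcond /=; apply: eq_bigl => j; rewrite eq_sym.
by rewrite mul2n -addnn -!addnA.
Qed.

(** The line of the first pair is met again at most [2 * \sum_(j < m) srw R (2 * j) 0] times on
    average, and each such meeting counts twice. *)
Lemma avg_collisions y m :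
  avg lazy_steps m (fun s => (collisions (lines y s))%:R) <=
  m%:R * (1 + 4 * \sum_(j < m) srw R (2 * j) 0).
Proof.
elim: m y => [|m IH] y; first by rewrite /= /collisions big_nil mul0r.
pose B := \sum_(j < m) srw R (2 * j) 0.
have step d : avg lazy_steps m (fun s => (collisions (lines y (d :: s)))%:R) <=
    1 + 4 * B + m%:R * (1 + 4 * B).
  rewrite /=.
  under eq_avg => s do rewrite collisions_cons natrD natrD natrM.
  rewrite !avgD avg_cst; last exact: lazy_distribution.
  rewrite avgZ; have := avg_count_lines (line y d) (y + d) m; have := IH (y + d).
  by rewrite -/B; lra.
rewrite avg_lazyS.
have h0 := step 0; have h1 := step 1; have h2 := step (-1).
rewrite big_ord_recr /= -/B.
have c0 : 0 <= m.+1%:R * srw R (2 * m) 0 by rewrite mulr_ge0 // srw_ge0.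
move: h0 h1 h2 c0; rewrite -[m.+1%:R]natr1; set N : R := m%:R.
move: (srw R (2 * m) 0) => c; lra.
Qed.

(** Chebyshev's inequality for each pair: the square of its line is at most [2 * h ^+ 2 + 2], with
    [h] the height before the pair, and the second moment of the height grows by 1/2 per pair. *)
Lemma avg_far y m (r : nat) :
  avg lazy_steps m (fun s => (count (fun l => r%:Z < `|l|)%R (lines y s))%:R)
    * r%:R ^+ 2 <= m%:R * (2 * y%:~R ^+ 2 + m%:R + 2) :> R.
Proof.
elim: m y => [|m IH] y; first by rewrite /= mulr0n !mul0r.
rewrite avg_lazyS /=.
have step d : d \in [:: 0; 1; -1 : int] ->
  avg lazy_steps m (fun s => ((r%:Z < `|line y d|)%R +
       count (fun l => r%:Z < `|l|)%R (lines (y + d) s))%:R) * r%:R ^+ 2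
   <= 2 * y%:~R ^+ 2 + 2 + m%:R * (2 * (y + d)%:~R ^+ 2 + m%:R + 2) :> R.
  move=> dd; under eq_avg => s do rewrite natrD.
  rewrite avgD avg_cst; last exact: lazy_distribution.
  rewrite mulrDl; apply: lerD (IH _).
  have [rl|rl] := ltP; last by rewrite mul0r; have := sqr_ge0 (y%:~R : R); lra.
  rewrite mul1r.
  have : r%:Z ^+ 2 <= 2 * y ^+ 2 + 2.
    move: dd rl; rewrite !inE /line => /or3P[] /eqP -> /=; nia.
  rewrite -(ler_int R).
  have -> : (r%:Z ^+ 2)%:~R = r%:R ^+ 2 :> R by rewrite rmorphXn.
  have -> : (2 * y ^+ 2 + 2)%:~R = 2 * y%:~R ^+ 2 + 2 :> R by ring.
  lra.
have h0 := step 0 isT; have h1 := step 1 isT; have h2 := step (-1) isT.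
rewrite !intrD mulr0z mulrN1z mulr1z in h0 h1 h2.
move: h0 h1 h2; rewrite -[m.+1%:R]natr1.
have m0 : 0 <= m%:R :> R by [].
move: m0; set N : R := m%:R; move: (r%:R ^+ 2 : R) (y%:~R : R) => r2 Y.
move: (avg _ _ _) (avg _ _ _) (avg _ _ _) => a b c.
lra.
Qed.

(** * The number of pairs that keep the height *)

Lemma avg_lazy_zeros n phi :
  avg lazy_steps n.+1 (fun s => phi (count_mem 0 s)) =
  (avg lazy_steps n (fun s => phi (count_mem 0 s).+1) +
   avg lazy_steps n (fun s => phi (count_mem 0 s))) / 2 :> R.
Proof.
have e d : avg lazy_steps n (fun s => phi (count_mem 0 (d :: s))) =
  avg lazy_steps n (fun s => phi ((d == 0) + count_mem (0 : int) s)%N) by [].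
rewrite avg_lazyS (e 0) (e 1) (e (-1)) eqxx /=.
by field.
Qed.

(** The size-bias identity of the binomial law with parameter 1/2. *)
Lemma avg_lazy_zeros_bias n g :
  avg lazy_steps n.+1 (fun s => (count_mem 0 s)%:R * g (count_mem 0 s)) =
  n.+1%:R / 2 * avg lazy_steps n (fun s => g (count_mem 0 s).+1) :> R.
Proof.
elim: n g => [|n IH] g.
  by rewrite (avg_lazy_zeros 0 (fun k => k%:R * g k)) /=; ring.
rewrite (avg_lazy_zeros n.+1 (fun k => k%:R * g k)) IH.
under eq_avg => s do rewrite -natr1 mulrDl mul1r.
rewrite avgD (IH (fun k => g k.+1)) (avg_lazy_zeros n (fun k => g k.+1)).
by rewrite -[n.+2%:R]natr1; field.
Qed.

(** The size-bias identity for [g k = 1 / k]: then [k * g k] is at most 1, being 0 at [k = 0] by the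
    convention on inverses. *)
Lemma avg_lazy_zeros_inv n :
  avg lazy_steps n (fun s => (count_mem 0 s).+1%:R^-1) <= 2 / n.+1%:R :> R.
Proof.
have n0 : 0 < n.+1%:R :> R by [].
rewrite ler_pdivlMr // mulrC.
have := avg_lazy_zeros_bias n (fun k => k%:R^-1).
suff : avg lazy_steps n.+1
    (fun s => (count_mem 0 s)%:R * (count_mem 0 s)%:R^-1 : R) <= 1.
  by lra.
rewrite -[leRHS](avg_cst n.+1 1 lazy_distribution).
apply: le_avg lazy_distribution _ => s _ _.
have [->|k0] := eqVneq (count_mem 0 s) 0%N; first by rewrite mul0r.
by rewrite divff // pnatr_eq0.
Qed.

Lemma avg_lazy_end n y :
  avg lazy_steps n (fun s => (y + \sum_(d <- s) d == 0)%:R) <= srw R (2 * n) 0.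
Proof. by rewrite lazy_pmf srw_even_max. Qed.

(** * Lines within reach and how often they are used *)

Definition window (b : nat) : seq int :=
  [seq i%:Z - b%:Z | i <- iota 0 (2 * b).+1].

Lemma mem_window b (y : int) : (y \in window b) = (`|y| <= b%:Z).
Proof.
apply/mapP/idP => [[i]|yb]; first by rewrite mem_iota => /andP[_ ib] ->; lia.
by exists `|(y + b%:Z)%R|%N; [rewrite mem_iota|]; lia.
Qed.

Lemma uniq_window b : uniq (window b).
Proof. by rewrite map_inj_uniq ?iota_uniq // => i j; lia. Qed.

Lemma sum_by_line (Y ls : seq int) (f : int -> R) : uniq Y -> {subset ls <= Y} ->
  \sum_(l <- ls) f l = \sum_(y <- Y) (count_mem y ls)%:R * f y.
Proof.
move=> uY; elim: ls => [|l ls IH] sub.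
  by rewrite big_nil big1 // => y _; rewrite mul0r.
rewrite big_cons IH; last by move=> x xl; apply: sub; rewrite inE xl orbT.
have lY : l \in Y by apply: sub; rewrite mem_head.
rewrite !(bigD1_seq l) //= eqxx natrD mulrDl mul1r addrA; congr (_ + _).
by apply: eq_bigr => y yl; rewrite eq_sym (negbTE yl).
Qed.

Definition frequent (b L : nat) (ls : seq int) : nat :=
  count (fun y => L <= count_mem y ls)%N (window b).

Lemma natr_count (T : Type) (p : pred T) (s : seq T) :
  (count p s)%:R = \sum_(x <- s) (p x)%:R :> R.
Proof. by elim: s => [|x s IH]; rewrite ?big_nil // big_cons /= natrD IH. Qed.

(* A line visited [a] times satisfies [a <= kappa] or [a <= a^2 / kappa]. *)
Lemma size_le_frequent (b L r : nat) (kappa : R) (ls : seq int) : 0 < kappa ->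
    {in ls, forall l, `|l| <= b%:Z} ->
  (size ls)%:R <= kappa * (frequent b L ls)%:R + (collisions ls)%:R / kappa
    + ((2 * r).+1 * L)%:R + (count (fun l => r%:Z < `|l|)%R ls)%:R.
Proof.
move=> k0 lb; have sub : {subset ls <= window b}.
  by move=> l /lb; rewrite mem_window.
have uY := uniq_window b.
have -> : (size ls)%:R = \sum_(y <- window b) (count_mem y ls)%:R :> R.
  rewrite -sum1_size natr_sum (sum_by_line _ uY sub).
  by apply: eq_bigr => y _; rewrite mulr1.
have -> : (collisions ls)%:R = \sum_(y <- window b) (count_mem y ls)%:R ^+ 2 :> R.
  rewrite natr_sum (sum_by_line (fun l => (count_mem l ls)%:R) uY sub).
  by apply: eq_bigr => y _; rewrite expr2.
have -> : (count (fun l => r%:Z < `|l|)%R ls)%:R =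
   \sum_(y <- window b) (count_mem y ls)%:R * (r%:Z < `|y|)%R%:R :> R.
  by rewrite natr_count (sum_by_line _ uY sub).
have -> : (frequent b L ls)%:R = \sum_(y <- window b) (L <= count_mem y ls)%N%:R :> R.
  exact: natr_count.
have h : \sum_(y <- window b) (`|y| <= r%:Z)%R%:R * L%:R <= ((2 * r).+1 * L)%:R :> R.
  rewrite -big_distrl /= natrM; apply: ler_wpM2r => //.
  have -> : \sum_(y <- window b) (`|y| <= r%:Z)%R%:R =
       (size [seq y <- window b | (`|y| <= r%:Z)%R])%:R :> R.
    by rewrite size_filter natr_count.
  rewrite ler_nat; have -> : (2 * r).+1 = size (window r) by rewrite size_map size_iota.
  apply: uniq_leq_size; first exact: filter_uniq.
  by move=> y; rewrite mem_filter [y \in window r]mem_window => /andP[].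
apply: le_trans (lerD (lerD (lexx _) h) (lexx _)).
rewrite big_distrr big_distrl -!big_split /=; apply: ler_sum => y _.
have a0 : 0 <= (count_mem y ls)%:R :> R by [].
have L0 : 0 <= L%:R :> R by [].
have q0 : 0 <= (count_mem y ls)%:R ^+ 2 / kappa :> R.
  by rewrite divr_ge0 // ?exprn_ge0 // ltW.
(* Each line is charged to one term: far lines to the last, near lines used fewer than [L] times to
   the third, the other near lines to one of the first two. *)
have [far|near] := ltP r%:Z `|y|.
  by rewrite mulr1 mul0r; case: (_ <= _)%N; rewrite ?mulr1 ?mulr0; lra.
rewrite mulr0 mul1r; have [big|small] := leqP L (count_mem y ls); last first.
  have : (count_mem y ls)%:R <= L%:R :> R by rewrite ler_nat ltnW.
  by rewrite mulr0; lra.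
have [ak|ka] := leP (count_mem y ls)%:R kappa; first by rewrite mulr1; lra.
suff : (count_mem y ls)%:R <= (count_mem y ls)%:R ^+ 2 / kappa by rewrite mulr1; lra.
by rewrite ler_pdivlMr // expr2; apply: ler_wpM2l => //; exact: ltW.
Qed.

(** On the event, [size_le_frequent] leaves at least [m / 2] to the collision and far terms;
    Markov's inequality concludes with their means. *)
Lemma avg_infrequent (b L r m M : nat) (kappa : R) : 0 < kappa -> (m <= b)%N ->
    (0 < r)%N ->
    kappa * (M * M)%:R + ((2 * r).+1 * L)%:R <= m%:R / 2 ->
  avg lazy_steps m (fun s => (frequent b L (lines 0 s) < M * M)%N%:R) * m%:R <=
  2 * (m%:R * (1 + 4 * \sum_(j < m) srw R (2 * j) 0) / kappa +
       m%:R * (m%:R + 2) / r%:R ^+ 2).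
Proof.
move=> k0 mb r0 hm; rewrite mulrC -avgZ.
have r20 : 0 < r%:R ^+ 2 :> R by rewrite exprn_gt0 // ltr0n.
have c1 := avg_collisions 0 m; have c2 := avg_far 0 m r.
apply: le_trans (_ : avg lazy_steps m (fun s =>
   2 * (kappa^-1 * (collisions (lines 0 s))%:R +
   (count (fun l => r%:Z < `|l|)%R (lines 0 s))%:R)) <= _); last first.
  rewrite avgZ avgD avgZ; apply: ler_wpM2l => //; apply: lerD.
    by rewrite mulrC; apply: ler_wpM2r; rewrite // invr_ge0 ltW.
  rewrite ler_pdivlMr //; apply: le_trans c2 _.
  by rewrite mulr0z expr0n mulr0 add0r.
apply: le_avg lazy_distribution _ => s ss smu.
have q0 : 0 <= kappa^-1 * (collisions (lines 0 s))%:R.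
  by rewrite mulr_ge0 // invr_ge0 ltW.
have [few|] := ltnP; last first.
  by move=> _; rewrite mulr0 mulr_ge0 // addr_ge0.
rewrite mulr1.
have lb : {in lines 0 s, forall l, `|l| <= b%:Z}.
  apply: lines_bounded; last by rewrite normr0 add0r ss.
  exact: smu.
have := size_le_frequent L r k0 lb; rewrite size_lines ss.
have : kappa * (frequent b L (lines 0 s))%:R <= kappa * (M * M)%:R.
  by apply: ler_wpM2l; [exact: ltW|rewrite ler_nat ltnW].
rewrite [_ / kappa]mulrC; lra.
Qed.

End Levels.

(** * The averaged return probability *)

Section Annealed.
Variable R : realFieldType.

(* The signs [c] are read along [window b]; outside of it the sign is 1. *)
Definition line_sign (b : nat) (c : seq int) (y : int) : int :=
  nth 1 c (index y (window b)).

Lemma sum_line_sign b (c ls : seq int) : {subset ls <= window b} ->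
    size c = size (window b) ->
  \sum_(l <- ls) line_sign b c l =
  dot c [seq (count_mem y ls)%:Z | y <- window b].
Proof.
rewrite /line_sign; move: (window b) (uniq_window b) => Y uY sub sc.
have -> : \sum_(l <- ls) nth 1 c (index l Y) =
    \sum_(y <- Y) (count_mem y ls)%:Z * nth 1 c (index y Y).
  elim: ls sub => [|l ls IH] sub.
    by rewrite big_nil big1 // => y _; rewrite mul0r.
  rewrite big_cons IH; last by move=> x xl; apply: sub; rewrite inE xl orbT.
  have lY : l \in Y by apply: sub; rewrite mem_head.
  rewrite !(bigD1_seq l) //= eqxx PoszD mulrDl mul1r addrA; congr (_ + _).
  by apply: eq_bigr => y yl; rewrite eq_sym (negbTE yl).
have sA : size [seq (count_mem y ls)%:Z | y <- Y] = size Y by exact: size_map.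
rewrite /dot (big_nth 0) (big_nth (0, 0)) size2_zip ?sA ?sc //.
rewrite !big_nat; apply: eq_bigr => i /andP[_ ib].
rewrite nth_zip ?sA //= (nth_map 0) //.
rewrite [LHS]mulrC index_uniq //.
by rewrite (set_nth_default 0) ?sc.
Qed.

(** A pair that keeps the height moves the abscissa by [2 * e y] or by 0, that is, by [e y] plus a
    fair sign; a pair that changes it moves the abscissa by [e] of its line. The fair signs,
    [count_mem 0 z] in number, must cancel the rest, and [srw] is symmetric. *)
Definition return_weight (n : nat) (e : int -> int) (x y : int) : R :=
  avg lazy_steps n (fun z => (y + \sum_(d <- z) d == 0)%:R *
     srw R (count_mem 0 z) (x + \sum_(l <- lines y z) e l)).

Definition annealed (n b : nat) : R :=
  avg signs (size (window b)) (fun c => return_weight n (line_sign b c) 0 0).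

(** For small [v], the order [k^(-1/2)] is made linear in [1 / k.+1], whose mean is available; for
    large [v], [srw_le_inv] suffices. *)
Lemma srw_split k v (T : nat) (lam : R) : 0 < lam ->
  srw R k v <= lam / k.+1%:R + (`|v| <= T%:Z)%R%:R / (2 * lam) + T.+1%:R^-1.
Proof.
move=> l0; have k0 : 0 < k.+1%:R :> R by [].
have T0 : 0 < T.+1%:R :> R by [].
have a0 : 0 <= lam / k.+1%:R by rewrite divr_ge0 // ltW.
have [vT|Tv] := leP `|v| T%:Z; last first.
  have h : T.+1%:R * srw R k v <= 1.
    apply: le_trans (srw_le_inv R k v); apply: ler_wpM2r; first exact: srw_ge0.
    have : T.+1%:Z <= `|v| by lia.
    by rewrite -(ler_int R) -[T.+1%:Z%:~R]/(T.+1%:R : R); lra.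
  rewrite mul0r addr0; apply: le_trans (_ : T.+1%:R^-1 <= _); last by rewrite lerDr.
  by rewrite -[leRHS]mul1r ler_pdivlMr // mulrC.
have T1 : 0 <= T.+1%:R^-1 :> R by rewrite invr_ge0.
have h := srw_sqr R k v.
have h2 : lam * srw R k v ^+ 2 <= 2 * (lam / k.+1%:R).
  rewrite [leRHS]mulrCA; apply: ler_wpM2l; first exact: ltW.
  by rewrite ler_pdivlMr.
(* AM-GM: [2 s <= lam s^2 + 1 / lam]. *)
suff : 2 * srw R k v <= lam * srw R k v ^+ 2 + lam^-1.
  rewrite mul1r invfM => h3; move: h2 h3 T1; set s := srw R k v.
  by move: (lam^-1) (lam / _) (lam * s ^+ 2) (T.+1%:R^-1) => u w t q; lra.
rewrite -subr_ge0.
have -> : lam * srw R k v ^+ 2 + lam^-1 - 2 * srw R k v =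
   (lam * srw R k v - 1) ^+ 2 / lam.
  by field; rewrite gt_eqF.
by rewrite divr_ge0 ?sqr_ge0 // ltW.
Qed.

Lemma frequent_cat b L ls ls' : (frequent b L ls <= frequent b L (ls ++ ls'))%N.
Proof.
apply: sub_count => y /=; rewrite count_cat => h.
by apply: leq_trans h (leq_addr _ _).
Qed.

Lemma annealed_split (m m' b L r M T : nat) (lam : R) : 0 < lam ->
    (m + m' <= b)%N -> (0 < L)%N -> (0 < M)%N -> (2 * T + 1 <= 2 * L * r)%N ->
  annealed (m + m') b <= srw R (2 * m') 0 *
    (2 * lam / m.+1%:R + (2 * r%:R / M%:R +
      avg lazy_steps m (fun s => (frequent b L (lines 0 s) < M * M)%N%:R))
        / (2 * lam) + T.+1%:R^-1).
Proof.
move=> l0 mb L0 M0 TL.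
(* With the height path [z] fixed, [h z] bounds the average over the signs: by [srw_split], then by
   [small_ball] unless too few lines are frequent. *)
pose h (z : seq int) : R := lam / (count_mem 0 z).+1%:R + (2 * r%:R / M%:R +
      (frequent b L (lines 0 z) < M * M)%N%:R) / (2 * lam) + T.+1%:R^-1.
have l20 : 0 <= (2 * lam)^-1 by rewrite invr_ge0 mulr_ge0 // ltW.
rewrite /annealed /return_weight avg_exchange.
apply: le_trans (_ : avg lazy_steps (m + m')
   (fun z => (\sum_(d <- z) d == 0)%:R * h z) <= _).
  apply: le_avg lazy_distribution _ => z sz zmu.
  rewrite avgZ add0r; apply: ler_wpM2l => //.
  have sub : {subset lines 0 z <= window b}.
    have : {in lines 0 z, forall l, `|l| <= b%:Z}.
      by apply: lines_bounded; [exact: zmu|rewrite normr0 add0r sz; lia].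
    by move=> hb l /hb; rewrite mem_window.
  pose A := [seq (count_mem y (lines 0 z))%:Z | y <- window b].
  have sA : size A = size (window b) by rewrite size_map.
  apply: le_trans (_ : avg signs (size A) (fun c =>
      (lam / (count_mem 0 z).+1%:R + T.+1%:R^-1) +
      (2 * lam)^-1 * (`|dot c A| <= T%:Z)%R%:R) <= _).
    rewrite sA; apply: le_avg signs_distribution _ => c sc _.
    rewrite add0r (sum_line_sign sub sc) -/A.
    have := srw_split (count_mem 0 z) (dot c A) T l0.
    by rewrite addrAC [_ / (2 * lam)]mulrC.
  rewrite avgD avg_cst; last exact: signs_distribution.
  rewrite avgZ /h [_ / (2 * lam)]mulrC.
  set S := avg _ _ _.
  suff : S <= 2 * r%:R / M%:R + (frequent b L (lines 0 z) < M * M)%N%:R.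
    move=> /(ler_wpM2l l20) Sb; rewrite addrAC.
    by do 2 apply: lerD => //.
  have g0 : 0 <= 2 * r%:R / M%:R :> R by rewrite divr_ge0 // mulr_ge0.
  have [few|many] := ltnP.
    apply: le_trans (_ : 1 <= _); last by rewrite lerDr.
    rewrite -(avg_cst (size A) 1 signs_distribution).
    by apply: le_avg signs_distribution _ => c _ _; rewrite lern1 leq_b1.
  rewrite addr0; apply: (@small_ball R L%:Z T%:Z A r M) => //.
  apply: leq_trans many _; by rewrite [count _ A]count_map /frequent.
rewrite avg_cat.
apply: le_trans (_ : avg lazy_steps m (fun s => srw R (2 * m') 0 * h s) <= _).
  apply: le_avg lazy_distribution _ => s _ _.
  have hs0 : 0 <= h s.
    rewrite /h !addr_ge0 ?divr_ge0 ?invr_ge0 ?addr_ge0 ?divr_ge0 ?mulr_ge0 //;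
      exact: ltW.
  apply: le_trans (ler_wpM2r hs0 (avg_lazy_end R m' (\sum_(d <- s) d))).
  rewrite mulrC -avgZ; apply: le_avg lazy_distribution _ => t _ _.
  rewrite big_cat /= mulrC; apply: ler_wpM2r => //.
  (* Dropping [t] can only lower [count_mem 0] and [frequent], hence only raise [h]; [t] then enters
     through the return to height 0 alone. *)
  rewrite /h count_cat lines_cat; apply: lerD => //; apply: lerD.
    apply: ler_wpM2l; first exact: ltW.
    by rewrite lef_pV2 ?posrE // ler_nat ltnS leq_addr.
  apply: ler_wpM2r => //; apply: lerD => //; rewrite ler_nat.
  have fc := frequent_cat b L (lines 0 s) (lines (0 + \sum_(d <- s) d) t).
  by case: ltnP => // /(leq_ltn_trans fc) ->.
rewrite avgZ; apply: ler_wpM2l; first exact: srw_ge0.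
rewrite /h avgD avg_cst; last exact: lazy_distribution.
rewrite lerD2r avgD; apply: lerD.
  rewrite avgZ mulrAC [leRHS]mulrC; apply: ler_wpM2l; first exact: ltW.
  exact: avg_lazy_zeros_inv.
under eq_avg => s do rewrite mulrC.
rewrite avgZ avgD avg_cst; last exact: lazy_distribution.
by rewrite mulrC.
Qed.

Lemma annealed_le1 n b : annealed n b <= 1.
Proof.
rewrite -(avg_cst (size (window b)) 1 signs_distribution).
apply: le_avg signs_distribution _ => c _ _.
rewrite -(avg_cst n 1 lazy_distribution).
apply: le_avg lazy_distribution _ => z _ _.
have : srw R (count_mem 0 z) (0 + \sum_(l <- lines 0 z) line_sign b c l) <= 1.
  set v := _ + _; have := srw_le_inv R (count_mem 0 z) v.
  have : 0 <= (`|v|)%:~R * srw R (count_mem 0 z) v.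
    by rewrite mulr_ge0 ?srw_ge0 // ler0z.
  by rewrite mulrDl mul1r; lra.
case: (_ == 0); rewrite ?mul1r ?mul0r // => _.
Qed.

End Annealed.

(** * Summability *)

Section Summation.
Variable R : realFieldType.

Lemma le_of_sqr (x y : R) : 0 <= y -> x ^+ 2 <= y ^+ 2 -> x <= y.
Proof.
move=> y0 h; have [x0|x0] := leP 0 x; last by apply: le_trans y0; exact: ltW.
by rewrite -(@ler_pXn2r _ 2) ?nnegrE.
Qed.

(** With [n] of order [q ^ 26], the bound is of order [n^(-1 - 1/26)]. *)
Lemma annealed_block (q n : nat) (D : R) : (24 <= q)%N -> 1 <= D ->
    (q ^ 26 <= n)%N -> n%:R <= D ^+ 2 * q%:R ^+ 26 ->
  annealed R n n * q%:R ^+ 27 <= 7 + 5 * D + D ^+ 2.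
Proof.
move=> q24 D1 qn nD.
have q0 : (0 < q)%N by apply: (leq_trans _ q24).
have n24 : (24 <= n)%N.
  apply: (leq_trans q24 (leq_trans _ qn)).
  by rewrite -[X in (X <= _)%N]expn1 leq_exp2l //; apply: (leq_trans _ q24).
have nX : q%:R ^+ 26 <= n%:R :> R by rewrite -natrX ler_nat.
clear qn; pose m := n./2; pose m' := (n - m)%N.
have [en h1 h2 [h3 h4 h5 mn' mlen]] : [/\ n = (m + m')%N, (n <= (2 * m).+1)%N,
    (2 * m <= n)%N & [/\ (m + 2 <= n)%N, (n <= 3 * m)%N, (0 < m)%N,
    (n <= (2 * m').+1)%N & (m <= n)%N]].
  by clear -n24; rewrite /m' /m; split; [lia..|split; lia].
set X : R := q%:R in nX *; have X24 : 24 <= X by rewrite ler_nat.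
have X0 : 0 < X by lra.
have P k : 0 < X ^+ k by rewrite exprn_gt0.
have mE : n%:R <= 2 * m%:R + 1 :> R by rewrite -natrM natr1 ler_nat.
have mn : 2 * m%:R <= n%:R :> R by rewrite -natrM ler_nat.
have mn2 : m%:R + 2 <= n%:R :> R by rewrite -natrD ler_nat.
have m3 : n%:R <= 3 * m%:R :> R by rewrite -natrM ler_nat.
have m0 : 0 < m%:R :> R by rewrite ltr0n.
have hX26 : 24 * X ^+ 25 <= X ^+ 26 by rewrite (exprS X 25) ler_wpM2r ?(ltW (P _)).
have hX25 : X ^+ 11 <= X ^+ 25 by apply: ler_weXn2l => //; lra.
have hTL : (2 * q ^ 14 + 1 <= 2 * q ^ 11 * (q ^ 3 + 1))%N.
  by rewrite mulnDr muln1 -mulnA -expnD leq_add2l muln_gt0 expn_gt0 q0.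
(* Up to small powers of q, the square root of n is q^13, so are the thresholds
   L = q^11 for occupation numbers, r = q^14 for heights and T = q^14 for |S|,
   and kappa = q^15, lam = q^12. The bound on the bad event uses the first half m
   of the path, the return to height 0 the second half m'. *)
have split := @annealed_split R m m' n (q ^ 11) (q ^ 3 + 1) (q ^ 5) (q ^ 14) (X ^+ 12)
   (P 12%N) (eq_leq (esym en)) ltac:(by rewrite expn_gt0 q0)
   ltac:(by rewrite expn_gt0 q0) hTL.
have bad := @avg_infrequent R n (q ^ 11) (q ^ 14) m (q ^ 5) (X ^+ 15)
   (P 15%N) mlen ltac:(by rewrite expn_gt0 q0).
rewrite -en in split.
(* The left side is [3 * X ^+ 25 + X ^+ 11], at most [4 * X ^+ 25]; then [24 <= X] and [n <= 3 * m]
   bring it below [m / 2]. *)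
have {}bad := bad ltac:(rewrite natrM natrX natrM -natr1 natrM !natrX -/X; lra).
move: split bad; set E := avg _ _ _.
set S := \sum_(j < m) _; set a := srw R (2 * m') 0.
rewrite !natrX natrD natrX -/X.
have S0 : 0 <= S by apply: sumr_ge0 => j _; exact: srw_ge0.
have SX : S <= D * X ^+ 13.
  apply: le_of_sqr; first by rewrite mulr_ge0 // ?ltW //; lra.
  rewrite exprMn -exprM; apply: le_trans nD; apply: le_trans mn.
  rewrite /S srw_center_sum natrM exprMn.
  have := srw_center_sqr R m; rewrite -natr1 natrM.
  have := sqr_ge0 (srw R (2 * m) 0).
  move: (srw R (2 * m) 0 ^+ 2) m0 => s; move: (m%:R : R) => t; nra.
have a0 : 0 <= a by exact: srw_ge0.
have aX : a * X ^+ 13 <= 1.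
  apply: le_of_sqr => //; rewrite exprMn -exprM expr1n.
  apply: le_trans (srw_center_sqr R m'); apply: ler_wpM2l; first exact: sqr_ge0.
  by apply: le_trans nX _; rewrite ler_nat.
move=> split bad.
have E2 : E * X ^+ 2 <= 10 * D + 2 * D ^+ 2.
  have h : E * m%:R <= m%:R * (2 * ((1 + 4 * S) / X ^+ 15 + (m%:R + 2) / X ^+ 28)).
    by move: bad; rewrite -[(X ^+ 14) ^+ 2]exprM; lra.
  rewrite mulrC ler_pM2l // in h.
  apply: le_trans (ler_wpM2r (ltW (P 2%N)) h) _.
  have e1 : (1 + 4 * S) / X ^+ 15 * X ^+ 2 <= 5 * D.
    have -> : (1 + 4 * S) / X ^+ 15 * X ^+ 2 = (1 + 4 * S) / X ^+ 13.
      by field; rewrite gt_eqF.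
    rewrite ler_pdivrMr //.
    have : 1 <= D * X ^+ 13.
      rewrite -[1]mulr1; apply: ler_pM => //; apply: exprn_ege1; lra.
    lra.
  have e2 : (m%:R + 2) / X ^+ 28 * X ^+ 2 <= D ^+ 2.
    have -> : (m%:R + 2) / X ^+ 28 * X ^+ 2 = (m%:R + 2) / X ^+ 26.
      by field; rewrite gt_eqF.
    by rewrite ler_pdivrMr //; apply: le_trans nD.
  lra.
set B := (X in _ <= a * X) in split.
have BX : B * X ^+ 14 <= 7 + 5 * D + D ^+ 2.
  have b1 : 2 * X ^+ 12 / m.+1%:R * X ^+ 14 <= 4.
    rewrite mulrAC ler_pdivrMr // -mulrA -exprD -natr1; lra.
  have b2 : (2 * (X ^+ 3 + 1) / X ^+ 5) * X ^+ 2 <= 4.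
    have -> : (2 * (X ^+ 3 + 1) / X ^+ 5) * X ^+ 2 = 2 * (X ^+ 3 + 1) / X ^+ 3.
      by field; rewrite gt_eqF.
    rewrite ler_pdivrMr //.
    have : 1 <= X ^+ 3 by apply: exprn_ege1; lra.
    lra.
  have b3 : (2 * (X ^+ 3 + 1) / X ^+ 5 + E) / (2 * X ^+ 12) * X ^+ 14 <=
     2 + 5 * D + D ^+ 2.
    have -> : (2 * (X ^+ 3 + 1) / X ^+ 5 + E) / (2 * X ^+ 12) * X ^+ 14 =
      ((2 * (X ^+ 3 + 1) / X ^+ 5) * X ^+ 2 + E * X ^+ 2) / 2.
      by field; rewrite gt_eqF.
    lra.
  have b4 : (q ^ 14).+1%:R^-1 * X ^+ 14 <= 1.
    rewrite mulrC ler_pdivrMr ?mul1r //.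
    by rewrite -natrX ler_nat.
  rewrite /B 2!mulrDl; apply: le_trans (lerD (lerD b1 b3) b4) _; lra.
have -> : annealed R n n * X ^+ 27 = annealed R n n * X ^+ 13 * X ^+ 14.
  by rewrite -mulrA -exprD.
have E0 : 0 <= E by apply: avg_ge0 => //; exact: lazy_distribution.
have P0 k : 0 <= X ^+ k := ltW (P k).
have B0 : 0 <= B.
  apply: addr_ge0; last by rewrite invr_ge0.
  apply: addr_ge0; first by rewrite divr_ge0 ?mulr_ge0.
  by rewrite divr_ge0 ?addr_ge0 ?divr_ge0 ?mulr_ge0 ?addr_ge0.
apply: le_trans BX; apply: ler_wpM2r; first exact: ltW.
apply: le_trans (ler_wpM2r (ltW (P 13%N)) split) _.
by rewrite mulrAC -[leRHS]mul1r; apply: ler_wpM2r.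
Qed.

(** Blocks between [2 ^ (26 * j)] and [2 ^ (26 * j.+1)], with [q = 2 ^ j] and [D = 2 ^ 13]: at most
    [2 ^ 26 * 2 ^ (26 * j)] terms, each at most [K / 2 ^ (27 * j)]. From [j = 5] on, [q] exceeds
    24. *)
Lemma annealed_summable :
  exists C : R, forall N, \sum_(n < N) annealed R n n <= C.
Proof.
pose K : R := 7 + 5 * 2 ^+ 13 + (2 ^+ 13) ^+ 2.
have K0 : 0 <= K by rewrite /K !addr_ge0 ?mulr_ge0 ?exprn_ge0.
pose C1 : R := 2 ^+ 26 * K.
have C10 : 0 <= C1 by rewrite mulr_ge0 ?exprn_ge0.
pose a j := (2 ^ (26 * j))%N.
have a_mono i j : (i <= j)%N -> (a i <= a j)%N.
  by move=> ij; rewrite leq_exp2l // leq_mul2l.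
have p0 n : 0 <= annealed R n n.
  apply: avg_ge0; first exact: signs_distribution.
  move=> c; apply: avg_ge0; first exact: lazy_distribution.
  by move=> z; rewrite mulr_ge0 // srw_ge0.
have block j : (5 <= j)%N ->
    \sum_(a j <= n < a j.+1) annealed R n n <= C1 / 2 ^+ j.
  move=> j5; apply: le_trans (_ : \sum_(a j <= n < a j.+1) (K / 2 ^+ (27 * j)) <= _).
    rewrite !big_nat; apply: ler_sum => n /andP[an na].
    rewrite ler_pdivlMr ?exprn_gt0 // mulnC exprM.
    have := @annealed_block (2 ^ j) n (2 ^+ 13); rewrite natrX; apply.
    - by apply: leq_trans (_ : 2 ^ 5 <= _)%N => //; rewrite leq_exp2l.
    - by apply: exprn_ege1; rewrite ler1n.
    - by rewrite -expnM mulnC.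
    - rewrite -!exprM -exprD -natrX ler_nat; apply: leq_trans (ltnW na) _.
      by rewrite leq_exp2l // mulnS mulnC.
  rewrite sumr_const_nat -[_ *+ (_ - _)]mulr_natl.
  apply: le_trans (_ : (2 ^+ 26 * 2 ^+ (26 * j)) * (K / 2 ^+ (27 * j)) <= _).
    apply: ler_wpM2r; first by rewrite divr_ge0 // exprn_ge0.
    by rewrite -exprD -natrX ler_nat /a mulnS leq_subr.
  rewrite -[(27 * j)%N]/((1 + 26) * j)%N mulnDl mul1n exprD.
  rewrite /C1 le_eqVlt; apply/orP; left; apply/eqP.
  have : 2 ^+ j != 0 :> R by rewrite expf_neq0 // pnatr_eq0.
  have : 2 ^+ (26 * j) != 0 :> R by rewrite expf_neq0 // pnatr_eq0.
  by move: (2 ^+ j) (2 ^+ (26 * j)) (2 ^+ 26) => x y w y0 x0; field; rewrite x0 y0.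
(* The subtracted term is the geometric tail still to come; the next block uses half of it. Terms
   before [a 5] are bounded by 1. *)
have head j : \sum_(0 <= n < a (5 + j)%N) annealed R n n <=
    (a 5)%:R + 2 * C1 - 2 * C1 / 2 ^+ (5 + j).
  elim: j => [|j IH].
    apply: le_trans (_ : (a 5)%:R <= _).
      rewrite addn0 -[X in X%:R]subn0 -sumr_const_nat.
      by apply: ler_sum => n _; exact: annealed_le1.
    rewrite -addrA lerDl subr_ge0 ler_pdivrMr ?exprn_gt0 //.
    by rewrite -[leLHS]mulr1 ler_wpM2l ?mulr_ge0 // exprn_ege1 // ler1n.
  rewrite addnS (big_cat_nat (n := a (5 + j)%N)) //=; last exact: a_mono.
  have := lerD IH (block (5 + j)%N (leq_addr _ _)).
  have -> : (2 ^+ (5 + j).+1)^-1 = 2^-1 * (2 ^+ (5 + j))^-1 :> R.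
    by rewrite exprS invfM.
  by move: ((2 ^+ (5 + j))^-1) => y; lra.
exists ((a 5)%:R + 2 * C1) => N.
have NaN : (N <= a (5 + N)%N)%N.
  apply: leq_trans (ltnW (ltn_expl N (isT : 1 < 2)%N)) _; rewrite /a leq_exp2l //; lia.
apply: le_trans (_ : \sum_(0 <= n < a (5 + N)%N) annealed R n n <= _).
  rewrite -(big_mkord xpredT (fun n => annealed R n n)).
  by rewrite [leRHS](big_cat_nat (n := N)) //= lerDl sumr_ge0.
apply: le_trans (head N) _; rewrite lerBlDr lerDl.
apply: divr_ge0; [exact: mulr_ge0|exact: exprn_ge0].
Qed.

End Summation.

(** * Return probabilities for a fixed orientation *)

Section Return.
Variable R : realFieldType.

Definition horizontal (e : int -> int) (v : int * int) : int * int :=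
  (v.1 + e v.2, v.2).

Definition vertical (v : int * int) : int * int :=
  (v.1, if (2 %| v.1 + v.2)%Z then v.2 - 1 else v.2 + 1).

Fixpoint return_prob (l : nat) (e : int -> int) (v : int * int) : R :=
  if l is l'.+1 then
    (return_prob l' e (horizontal e v) + return_prob l' e (vertical v)) / 2
  else (v == (0, 0))%:R.

Definition sign_valued (e : int -> int) := forall y, e y = 1 \/ e y = -1.

Lemma return_prob_ge0 l e v : 0 <= return_prob l e v.
Proof.
elim: l v => [|l IH] v //=.
by have := IH (horizontal e v); have := IH (vertical v); lra.
Qed.

Lemma return_prob_odd l e (v : int * int) : sign_valued e ->
  ~~ (2 %| v.1 + v.2 + l%:Z)%Z -> return_prob l e v = 0.
Proof.
move=> es; elim: l v => [|l IH] [x y] /=.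
  by move=> h; rewrite (_ : (_ == _) = false) //; apply/eqP => -[x0 y0]; lia.
move=> h; rewrite !IH ?addr0 ?mul0r //=.
  by case: ifP => ?; lia.
by case: (es y) => ->; lia.
Qed.

Lemma return_weightS n e x y : return_weight R n.+1 e x y =
  2^-1 * ((return_weight R n e (x + e y - 1) y +
           return_weight R n e (x + e y + 1) y) / 2) +
  4^-1 * (return_weight R n e (x + e y) (y + 1) +
          return_weight R n e (x + e (y - 1)) (y - 1)).
Proof.
rewrite /return_weight avg_lazyS; congr (_ * _ + _ * (_ + _)).
- rewrite -avgD mulrC -avgZ; apply: eq_avg => z.
  rewrite big_cons /= !big_cons /line /= addr0 add0r !addrA -!mulrDr.
  rewrite add0n.
  rewrite ![x + e y + _ + \sum_(l <- lines y z) e l]addrAC.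
  by ring.
- by apply: eq_avg => z; rewrite big_cons /= big_cons /line /= !addrA.
- by apply: eq_avg => z; rewrite big_cons /= big_cons /line /= !addrA.
Qed.

Lemma return_prob_even n e (x y : int) : sign_valued e -> (2 %| x + y)%Z ->
  return_prob (2 * n) e (x, y) = return_weight R n e x y.
Proof.
move=> es; elim: n x y => [|n IH] x y xy.
  rewrite muln0 /return_weight /= !big_nil !addr0 -natrM.
  by rewrite xpair_eqE andbC; case: (y == 0); case: (x == 0).
rewrite (_ : (2 * n.+1 = (2 * n).+2)%N) /=; last by lia.
rewrite /horizontal /vertical /= xy /=.
have -> : (2 %| x + e y + y)%Z = false by case: (es y) => ->; lia.
have -> : (2 %| x + (y - 1))%Z = false by lia.
have h1 : (2 %| x + e (y - 1) + (y - 1))%Z by case: (es (y - 1)) => ->; lia.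
have h2 : (2 %| x + e y + (y + 1))%Z by case: (es y) => ->; lia.
have h3 : (2 %| x + e y + e y + y)%Z by case: (es y) => ->; lia.
rewrite return_weightS subrK !IH //.
(* Of [x + e y - 1] and [x + e y + 1], one is [x] (two vertical steps) and the other [x + e y + e y]
   (two horizontal ones). *)
by case: (es y) => ->; rewrite ?addrK ?subrK; field.
Qed.

(** In [n] pairs from height 0 only lines of [window n] are used, so the weight depends on finitely
    many signs. *)
Lemma return_weight_local n (e e' : int -> int) :
  {in window n, e =1 e'} -> return_weight R n e 0 0 = return_weight R n e' 0 0.
Proof.
move=> ee'; have eq z : size z = n -> {subset z <= [:: 0; 1; -1 : int]} ->
    \sum_(l <- lines 0 z) e l = \sum_(l <- lines 0 z) e' l.
  move=> sz zs; rewrite !big_seq; apply: eq_bigr => l ll.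
  apply: ee'; rewrite mem_window; move: l ll.
  by apply: lines_bounded => //; rewrite normr0 add0r sz.
by apply/eqP; rewrite eq_le; apply/andP; split;
  apply: le_avg lazy_distribution _ => z sz zs; rewrite eq.
Qed.

Lemma return_weight_line_sign n (e : int -> int) :
  return_weight R n e 0 0 =
  return_weight R n (line_sign n [seq e y | y <- window n]) 0 0.
Proof.
apply: return_weight_local => y yn.
by rewrite /line_sign (nth_map 0) ?index_mem // nth_index.
Qed.

Lemma return_weight_ge0 n e x y : 0 <= return_weight R n e x y.
Proof.
apply: avg_ge0; first exact: lazy_distribution.
by move=> z; rewrite mulr_ge0 // srw_ge0.
Qed.

Lemma sum_return_prob N e : sign_valued e ->
  \sum_(0 <= l < (2 * N)%N) return_prob l e (0, 0) =
  \sum_(0 <= n < N) return_weight R n e 0 0.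
Proof.
move=> es; elim: N => [|N IH]; first by rewrite !big_nil.
rewrite (_ : (2 * N.+1 = (2 * N).+2)%N); last by lia.
rewrite !big_nat_recr //= IH return_prob_even // -addrA; congr (_ + _).
rewrite -[X in _ + X]/(return_prob (2 * N).+1 e (0, 0)) return_prob_odd ?addr0 //=.
lia.
Qed.

End Return.

Local Open Scope classical_set_scope.
Local Open Scope ring_scope.

(** * Realizations of the walk *)

Section Quenched.
Variable R : realType.

Definition sign_of (e : int -> R) (y : int) : int := if e y == 1 then 1 else -1.

Lemma sign_of_valued e : sign_valued (sign_of e).
Proof. by move=> y; rewrite /sign_of; case: ifP; [left|right]. Qed.

Lemma arc_horizontal (e : int -> R) v : (forall y, e y = -1 \/ e y = 1) ->
  Defs.arc e v (horizontal (sign_of e) v).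
Proof.
move=> es; case: v => x y; rewrite /Defs.arc /horizontal /sign_of /=.
case: (es y) => ->; last by rewrite !eqxx.
have -> : (-1 == 1 :> R) = false by apply/eqP; lra.
by rewrite !eqxx /= subrK eqxx.
Qed.

Lemma arc_vertical (e : int -> R) v : Defs.arc e v (vertical v).
Proof.
case: v => x y; rewrite /Defs.arc /vertical /vertical_edge /=.
case: ifP => h /=; last by rewrite eqxx !orbT.
by rewrite subrK eqxx (_ : (2 %| x + (y - 1))%Z = false) ?orbT //; lia.
Qed.

Lemma horizontal_neq_vertical e v : sign_valued e -> horizontal e v <> vertical v.
Proof.
case: v => x y es; rewrite /horizontal /vertical /= => -[].
by case: (es y) => ->; lia.
Qed.

Variables (e : int -> R) (d : measure_display) (T : measurableType d)
  (Q : probability T R) (M : nat -> T -> vertex).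
Hypotheses (es : forall y, e y = -1 \/ e y = 1) (walk : simple_random_walk e Q M).

Let trajectory (n : nat) (x : nat -> vertex) : set T :=
  [set t | forall i : nat, (i <= n)%N -> M i t = x i].

Let extend (n : nat) (x : nat -> vertex) (v : vertex) (i : nat) : vertex :=
  if (i <= n)%N then x i else v.

Let measurable_at n v : measurable [set t | M n t = v].
Proof. by case: walk. Qed.

Let measurable_trajectory n x : measurable (trajectory n x).
Proof.
have -> : trajectory n x =
  \bigcap_(i in [set i | (i <= n)%N]) [set t | M i t = x i] by [].
by apply: bigcap_measurable => //; exists 0%N.
Qed.

Let trajectory_extend n x v :
  trajectory n.+1 (extend n x v) = trajectory n x `&` [set t | M n.+1 t = v].
Proof.
apply/seteqP; split=> [t h|t [h1 h2] i]; first split.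
- by move=> i ni; rewrite h ?(leqW ni) // /extend ni.
- by rewrite /= h // /extend ltnn.
- rewrite /extend leq_eqVlt => /orP[/eqP ->|]; first by rewrite ltnn.
  by rewrite ltnS => ni; rewrite ni; exact: h1.
Qed.

Let trajectory_arc n x v : Defs.arc e (x n) v ->
  Q (trajectory n.+1 (extend n x v)) = (Q (trajectory n x) * (2^-1)%:E)%E.
Proof.
move=> xv; case: walk => _ _ /(_ n (extend n x v)) /= ->.
rewrite /extend leqnn ltnn /step_prob xv; congr (Q _ * _)%E.
by apply/seteqP; split=> t h i ni; have := h i ni; rewrite ni.
Qed.

(** The Markov property, as an upper bound. The horizontal and the vertical continuation are
    disjoint and each carries half the mass of the trajectory, so all other continuations together
    are null. *)
Let trajectory_return l n x :
  (Q (trajectory n x `&` [set t | M (n + l)%N t = origin]) <=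
   Q (trajectory n x) * (return_prob R l (sign_of e) (x n))%:E)%E.
Proof.
elim: l n x => [|l IH] n x.
  rewrite addn0 /=; have [xo|xo] := eqVneq (x n) (0, 0).
    by rewrite mule1; apply: le_measure; rewrite ?inE //; exact: measurableI.
  rewrite mule0 (_ : _ `&` _ = set0) ?measure0 //.
  apply/seteqP; split=> // t [/(_ n (leqnn n))] /= ->.
  by move=> h; rewrite h eqxx in xo.
set F := [set t | M (n + l.+1)%N t = origin].
have mF : measurable F by exact: measurable_at.
set h := horizontal (sign_of e) (x n); set v := vertical (x n).
pose H := trajectory n.+1 (extend n x h); pose V := trajectory n.+1 (extend n x v).
have mH : measurable H by exact: measurable_trajectory.
have mV : measurable V by exact: measurable_trajectory.
have mX := measurable_trajectory n x.
have HX : H `<=` trajectory n x by rewrite /H trajectory_extend; exact: subIsetl.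
have VX : V `<=` trajectory n x by rewrite /V trajectory_extend; exact: subIsetl.
have HV : H `&` V = set0.
  apply/seteqP; split=> // t; rewrite /H /V !trajectory_extend => -[[_ Hh] [_ Vv]].
  apply: (@horizontal_neq_vertical (sign_of e) (x n) (sign_of_valued e)).
  by rewrite -/h -/v -Hh -Vv.
have QH : Q H = (Q (trajectory n x) * (2^-1)%:E)%E.
  by apply: trajectory_arc; exact: arc_horizontal.
have QV : Q V = (Q (trajectory n x) * (2^-1)%:E)%E.
  by apply: trajectory_arc; exact: arc_vertical.
have QHV : Q (H `|` V) = (Q H + Q V)%E by exact: measureU.
have qX : Q (trajectory n x) \is a fin_num by exact: fin_num_measure.
have null : Q (trajectory n x `\` (H `|` V)) = 0%E.
  rewrite measureD //; [|exact: measurableU|by rewrite -ge0_fin_numE].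
  rewrite (setIidr _); last by rewrite subUset.
  transitivity (Q (trajectory n x) - Q (H `|` V))%E => //.
  rewrite QHV QH QV -(fineK qX) -!EFinM -EFinD; congr EFin; lra.
have hR := return_prob_ge0 R l (sign_of e) h.
have vR := return_prob_ge0 R l (sign_of e) v.
apply: le_trans (_ : Q ((H `&` F) `|` (V `&` F) `|`
    (trajectory n x `\` (H `|` V))) <= _)%E.
  apply: le_measure; rewrite ?inE.
  - exact: measurableI.
  - apply: measurableU; first by apply: measurableU; exact: measurableI.
    by apply: measurableD => //; exact: measurableU.
  - move=> t [Xt Ft]; have [Ht|nH] := pselect (H t); first by left; left.
    have [Vt|nV] := pselect (V t); first by left; right.
    by right; split=> // -[].
have mHF : measurable (H `&` F) by exact: measurableI.
have mVF : measurable (V `&` F) by exact: measurableI.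
have u1 : (Q ((H `&` F) `|` (V `&` F) `|` (trajectory n x `\` (H `|` V))) <=
    Q ((H `&` F) `|` (V `&` F)) + Q (trajectory n x `\` (H `|` V)))%E.
  apply: measureU2; first exact: measurableU.
  by apply: measurableD => //; exact: measurableU.
have u2 : (Q ((H `&` F) `|` (V `&` F)) <= Q (H `&` F) + Q (V `&` F))%E.
  exact: measureU2.
apply: le_trans u1 _; rewrite null adde0; apply: le_trans u2 _.
have := IH n.+1 (extend n x v); have := IH n.+1 (extend n x h).
have eE w : extend n x w n.+1 = w by rewrite /extend ltnn.
rewrite addSnnS -/F -/H -/V !eE => IHh IHv; apply: le_trans (leeD IHh IHv) _.
rewrite QH QV -(fineK qX) -!EFinM -EFinD lee_fin /= -/h -/v. lra.
Qed.

Lemma walk_return_le l :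
  (Q [set t | M l t = origin] <= (return_prob R l (sign_of e) origin)%:E)%E.
Proof.
case: walk => _ Q0 _; pose x (_ : nat) := origin.
have X0 : trajectory 0 x = [set t | M 0%N t = origin].
  apply/seteqP; split=> t; first by move=> h; exact: (h 0%N).
  by move=> h i; rewrite leqn0 => /eqP ->.
have := trajectory_return l 0 x; rewrite X0 Q0 mul1e add0n; apply: le_trans.
have m0 := measurable_at 0 origin; have ml := measurable_at l origin.
have mC := measurableC m0.
(* The walk starts at the origin only almost surely. *)
have nullC : Q (~` [set t | M 0%N t = origin]) = 0%E.
  by rewrite probability_setC // Q0 subee.
rewrite -[leRHS]adde0 -nullC.
apply: le_trans (measureU2 _ _ _) => //; last exact: measurableI.
apply: le_measure; rewrite ?inE //.
  by apply: measurableU => //; exact: measurableI.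
by move=> t lt; have [?|?] := pselect (M 0%N t = origin); [left|right].
Qed.

End Quenched.

(** * Averaging over the orientation *)

Section RandomSigns.
Variables (R : realType) (d : measure_display) (Omega : measurableType d)
  (P : probability Omega R) (eps : int -> {RV P >-> R}).
Hypotheses (eps_rademacher : forall y, rademacher (eps y))
  (eps_independent : mutually_independent eps).

Let sgn (w : Omega) (y : int) : int := sign_of (fun y => eps y w) y.

Let cylinder (J : seq int) (s : int -> R) : set Omega :=
  [set w | forall j, j \in J -> eps j w = s j].

Let measurable_cylinder J s : measurable (cylinder J s).
Proof.
elim: J => [|j J IH].
  by rewrite (_ : cylinder _ _ = setT) //; apply/seteqP; split.
rewrite (_ : cylinder _ _ = eps j @^-1` [set s j] `&` cylinder J s).
  exact: measurableI.
apply/seteqP; split=> [w h|w [h1 h2] i].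
  by split=> [|i iJ]; apply: h; rewrite inE ?eqxx // iJ orbT.
by rewrite inE => /orP[/eqP ->|/h2].
Qed.

Let prob_cylinder J s : uniq J -> (forall j, s j = -1 \/ s j = 1) ->
  P (cylinder J s) = ((2^-1) ^+ size J)%:E.
Proof.
move=> uJ s1.
have -> := eps_independent (B := fun j => [set s j]) uJ
  (fun j => measurable_set1 (s j)).
elim: J {uJ} => [|j J IH]; first by rewrite big_nil expr0.
rewrite big_cons IH /= exprS EFinM; congr (_ * _)%E.
have [_ p1 pN1] := eps_rademacher j.
by case: (s1 j) => ->; [exact: pN1|exact: p1].
Qed.

Let measurable_signs (Y : seq int) (F : seq int -> R) :
  measurable_fun setT (fun w => F [seq sgn w y | y <- Y]).
Proof.
elim: Y F => [|y Y IH] F /=; first exact: measurable_cst.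
rewrite (_ : (fun w => _) = (fun w => if eps y w == 1
   then F (1 :: [seq sgn w y | y <- Y]) else F (-1 :: [seq sgn w y | y <- Y]))).
  apply: measurable_fun_ifT.
  - apply: measurable_fun_eqr; [exact: measurable_funP|exact: measurable_cst].
  - exact: (IH (fun s => F (1 :: s))).
  - exact: (IH (fun s => F (-1 :: s))).
by apply/funext => w; rewrite {1}/sgn /sign_of; case: ifP.
Qed.

(** [J] holds the lines whose sign is already revealed. The induction splits the cylinder by the
    sign of the next line of [Y] and moves that line to [J]. *)
Let integral_cylinder (Y J : seq int) (s : int -> R) (F : seq int -> R) :
  uniq (Y ++ J) -> (forall j, s j = -1 \/ s j = 1) -> (forall c, 0 <= F c) ->
  (\int[P]_(w in cylinder J s) (F [seq sgn w y | y <- Y])%:E =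
   (2^-1 ^+ size J * avg signs (size Y) F)%:E)%E.
Proof.
elim: Y J s F => [|y Y IH] J s F uYJ s1 F0.
  rewrite [LHS](integral_cst P (measurable_cylinder J s) (F [::])%:E) /=.
  by rewrite prob_cylinder // -EFinM mulrC.
have N11 : (-1 == 1 :> R) = false by apply/eqP; lra.
have yJ : y \notin J by move: uYJ; rewrite /= mem_cat negb_or => /andP[/andP[]].
pose upd b i : R := if i == y then b else s i.
have upd1 b : b = -1 \/ b = 1 -> forall j, upd b j = -1 \/ upd b j = 1.
  by move=> hb j; rewrite /upd; case: eqP.
have cE : cylinder J s = cylinder (y :: J) (upd 1) `|` cylinder (y :: J) (upd (-1)).
  have sub b : cylinder (y :: J) (upd b) `<=` cylinder J s.
    move=> w h j jJ; rewrite h ?inE ?jJ ?orbT // /upd.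
    by case: eqP jJ yJ => // -> ->.
  apply/seteqP; split; last by rewrite subUset; split; exact: sub.
  move=> w h; have [/(_ w) [] ey _ _] := eps_rademacher y; [right|left];
    move=> j; rewrite inE /upd; case: eqP => [->|_] //= jJ; exact: h.
have uYJ' : uniq (Y ++ y :: J).
  by rewrite uniq_catC /= mem_cat uniq_catC orbC -mem_cat; exact: uYJ.
rewrite cE ge0_integral_setU //=; first last.
- apply/disj_setPS => w [/(_ y) h1 /(_ y) h2].
  move: h1 h2; rewrite inE eqxx /upd eqxx /= => /(_ isT) -> /(_ isT) /eqP.
  by rewrite eq_sym N11.
- by move=> w _; rewrite lee_fin.
- apply/measurable_EFinP; apply: measurable_funTS.
  exact: (measurable_signs (y :: Y) F).
rewrite (eq_integral (fun w => (F (1 :: [seq sgn w y | y <- Y]))%:E)); last first.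
  move=> w; rewrite inE => /(_ y); rewrite inE eqxx => /(_ isT) h.
  by rewrite {1}/sgn /sign_of h /upd !eqxx.
rewrite (IH (y :: J) (upd 1) (fun c => F (1 :: c))) //; last by apply: upd1; right.
rewrite (eq_integral (fun w => (F (-1 :: [seq sgn w y | y <- Y]))%:E)); last first.
  move=> w; rewrite inE => /(_ y); rewrite inE eqxx => /(_ isT) h.
  by rewrite {1}/sgn /sign_of h /upd eqxx N11.
rewrite (IH (y :: J) (upd (-1)) (fun c => F (-1 :: c))) //; last by apply: upd1; left.
rewrite -EFinD -[size (y :: J)]/(size J).+1 !big_cons big_nil exprS /=.
by congr EFin; field.
Qed.

Lemma integral_signs (Y : seq int) (F : seq int -> R) :
  uniq Y -> (forall c, 0 <= F c) ->
  (\int[P]_w (F [seq sgn w y | y <- Y])%:E = (avg signs (size Y) F)%:E)%E.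
Proof.
move=> uY F0; have := @integral_cylinder Y [::] (fun=> 1) F.
rewrite cats0 expr0 mul1r (_ : cylinder _ _ = setT); last by apply/seteqP; split.
by apply=> //; right.
Qed.

Lemma integral_return_weight n :
  (\int[P]_w (return_weight R n (sgn w) 0 0)%:E = (annealed R n n)%:E)%E.
Proof.
rewrite -integral_signs; [|exact: uniq_window|by move=> c; exact: return_weight_ge0].
by apply: eq_integral => w _; rewrite return_weight_line_sign.
Qed.

Lemma measurable_return_weight n :
  measurable_fun setT (fun w => (return_weight R n (sgn w) 0 0)%:E).
Proof.
apply/measurable_EFinP.
rewrite (_ : (fun w => _) = (fun w => return_weight R n
   (line_sign n [seq sgn w y | y <- window n]) 0 0)).
  exact: (measurable_signs (window n) (fun c => return_weight R n (line_sign n c) 0 0)).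
by apply/funext => w; rewrite return_weight_line_sign.
Qed.

(** By monotone convergence the expectation of the series is the sum of the [annealed] terms, which
    is finite; so the series is finite almost everywhere. *)
Lemma ae_summable_return_weight : {ae P, forall w,
  (\sum_(0 <= n <oo) (return_weight R n (sgn w) 0 0)%:E < +oo)%E}.
Proof.
have [C HC] := annealed_summable R.
pose G w : \bar R := (\sum_(0 <= n <oo) (return_weight R n (sgn w) 0 0)%:E)%E.
have G0 w : (0 <= G w)%E.
  by apply: nneseries_ge0 => n _ _; rewrite lee_fin return_weight_ge0.
have mG : measurable_fun setT G.
  apply: ge0_emeasurable_sum => n *; rewrite ?lee_fin ?return_weight_ge0 //.
  exact: measurable_return_weight.
have iG : P.-integrable setT G.
  apply/integrableP; split=> //.
  under eq_integral => w _ do rewrite gee0_abs //.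
  rewrite integral_nneseries //; last first.
  - by move=> n w _; rewrite lee_fin return_weight_ge0.
  - exact: measurable_return_weight.
  apply: (@le_lt_trans _ _ C%:E); last exact: ltry.
  apply: lime_le.
    apply: is_cvg_nneseries => n _ _; apply: integral_ge0 => w _.
    by rewrite lee_fin return_weight_ge0.
  apply: nearW => N.
  under eq_bigr => n _ do rewrite integral_return_weight.
  by rewrite sumEFin lee_fin big_mkord; exact: HC.
have := integrable_ae measurableT iG; apply: filterS => w /(_ I).
by rewrite ge0_fin_numE.
Qed.

End RandomSigns.

Theorem theorem1p1 (R : realType) (d : measure_display)
    (Omega : measurableType d) (P : probability Omega R)
    (eps : int -> {RV P >-> R})
    (eps_rademacher : forall y, rademacher (eps y))
    (eps_independent : mutually_independent eps) :
  {ae P, forall w, transient (fun y => eps y w)}.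
Proof.
have := ae_summable_return_weight eps_rademacher eps_independent.
apply: filterS => w Sw d' T Q M walk.
have es y : eps y w = -1 \/ eps y w = 1 by have [] := eps_rademacher y.
apply: le_lt_trans Sw; apply: lime_le.
  by apply: is_cvg_nneseries => n _ _; exact: measure_ge0.
apply: nearW => N.
set e := fun y => _ in walk; have sv := sign_of_valued e.
apply: le_trans (_ : \sum_(0 <= l < N) (return_prob R l (sign_of e) origin)%:E <= _)%E.
  by apply: lee_sum => l _; exact: walk_return_le es walk l.
(* Enlarging the range to [2 * N] lets the times be grouped in pairs; odd times contribute 0. *)
apply: le_trans (_ : \sum_(0 <= l < 2 * N)
    (return_prob R l (sign_of e) origin)%:E <= _)%E.
  rewrite !sumEFin lee_fin [leRHS](big_cat_nat (n := N)) //=; last lia.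
  by rewrite lerDl sumr_ge0 // => l _; exact: return_prob_ge0.
rewrite sumEFin sum_return_prob // -sumEFin.
by apply: nneseries_lim_ge => n _ _; rewrite lee_fin return_weight_ge0.
Qed.
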